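(* Let $q>0$, $n\in\mathbb{N}$, and let $\mu$ be a probability measure on $\mathbb{R}$ with an even density $\phi$ which has positive and integrable Fourier transform $\hat\phi$. Let $h:\mathbb{R}\to\mathbb{R}$ be an even function, in $L^2$, with $\hat h$ positive. Let $$H(a)=H(a_1,\ldots,a_n)=\int_{\mathbb{R}^n}h\left(a_1^{1/q}x_1+\cdots+a_n^{1/q}x_n\right)\mu^n(dx),\qquad a\in[0,+\infty)^n.$$ (i) If $\hat\phi(t^{1/q})$, for $t\ge 0$, is log-convex, then $H$ is log-convex. (ii) If $\hat\phi(t^{1/q})$, for $t\ge 0$, is log-concave, then $H$ is Schur concave.
   Context: Fourier transform convention: $\hat f(x)=\int_{\mathbb{R}}f(y)e^{-2\pi i xy}\,dy$ (extended to $L^2$ as usual). ''Positive'' for a Fourier transform means $\ge 0$. $\mu^n$ is the $n$-fold product measure on $\mathbb{R}^n$. A function $f:C\to[0,\infty)$ on a convex set $C$ is log-convex (resp. log-concave) if $f(\lambda x+(1-\lambda)y)\le f(x)^\lambda f(y)^{1-\lambda}$ (resp. $\ge$) for all $x,y\in C$, $\lambda\in(0,1)$. For $x,y\in\mathbb{R}^n$, write $x\prec y$ if, after rearranging the coordinates of each in decreasing order, $x_1+\cdots+x_i\le y_1+\cdots+y_i$ for $i=1,\ldots,n-1$ and $x_1+\cdots+x_n=y_1+\cdots+y_n$. A function $f$ is Schur concave if $x\prec y$ implies $f(x)\ge f(y)$ for all $x,y$ in its domain.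
   Formalization: In (i), log-convexity of H is claimed on [0,∞)^n without the origin, and on all of [0,∞)^n when 0 is a Lebesgue point of h (e.g. h continuous at 0); since H(0)=h(0), changing the L^2 function h at 0 alone can make the literal claim false. *)

(* Defs.v *)
From HB Require Import structures.
From mathcomp Require Import all_boot all_order all_algebra.
From mathcomp Require Import all_classical all_reals all_analysis.
From mathcomp Require Export complex.

Set Implicit Arguments.
Unset Strict Implicit.
Unset Printing Implicit Defensive.
Import Order.TTheory GRing.Theory Num.Theory.
Import numFieldNormedType.Exports.
Import ComplexField.Normc.

Local Open Scope classical_set_scope.
Local Open Scope ring_scope.

Section product_power.
Context d (T : measurableType d) (R : realType).

Definition tuple_cons n (p : T * n.-tuple T) : n.+1.-tuple T :=
  [the n.+1.-tuple T of p.1 :: p.2].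

Lemma measurable_tuple_cons n : measurable_fun setT (@tuple_cons n).
Proof.
exact: (measurable_cons (@measurable_fst _ _ T (n.-tuple T))
                        (@measurable_snd _ _ T (n.-tuple T))).
Qed.

HB.instance Definition _ n := isMeasurableFun.Build _ _ _ _ (@tuple_cons n)
  (@measurable_tuple_cons n).

Fixpoint power_probability (P : probability T R) n :
    probability (n.-tuple T) R :=
  match n with
  | 0 => \d_([tuple] : 0.-tuple T)
  | m.+1 => distribution (P \x power_probability P m)%E (@tuple_cons m)
  end.

End product_power.

Section fourier.
Context (R : realType).
Local Notation leb := (@lebesgue_measure R).

(* For z : R[i], [0 <= z] means that z is real and nonnegative. *)
Definition fourier (f : R -> R) (x : R) : R[i] :=
  ((\int[leb]_y (f y * cos (2 * pi * x * y)))
   -i* (\int[leb]_y (f y * sin (2 * pi * x * y))))%C.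

Definition complex_Lfun (p : \bar R) (g : R -> R[i]) : Prop :=
  (fun x => complex.Re (g x)) \in Lfun leb p /\ (fun x => complex.Im (g x)) \in Lfun leb p.

(* The continuous extension of [fourier] from the dense subspace L^1 & L^2;
   [g] is determined by [f] up to a null set. *)
Definition is_fourierL2 (f : R -> R) (g : R -> R[i]) : Prop :=
  complex_Lfun 2%:E g /\
  exists u : nat -> R -> R,
    [/\ forall k, u k \in Lfun leb 1%E /\ u k \in Lfun leb 2%:E,
        ('N[leb]_2%:E[(fun x => (u k x - f x)%:E)])%E @[k --> \oo] --> 0%E &
        ('N[leb]_2%:E[(fun x => (normc (fourier (u k) x - g x))%:E)])%E
          @[k --> \oo] --> 0%E].

Definition is_density (mu : probability (measurableTypeR R) R) (phi : R -> R) :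
    Prop :=
  [/\ measurable_fun setT phi, forall x, 0 <= phi x &
      forall A, measurable A -> mu A = (\int[leb]_(x in A) (phi x)%:E)%E].

Definition even_fun (f : R -> R) : Prop := forall x, f (- x) = f x.

End fourier.

Section convexity.
Context (R : realType).

(* Nonnegativity is part of the notions: [powR] is only meaningful on
   nonnegative bases. *)
Definition log_convex_on (V : lmodType R) (C : set V) (f : V -> R) : Prop :=
  (forall x, C x -> 0 <= f x) /\
  forall x y (l : R), C x -> C y -> 0 < l < 1 ->
    f (l *: x + (1 - l) *: y) <= f x `^ l * f y `^ (1 - l).

Definition log_concave_on (V : lmodType R) (C : set V) (f : V -> R) : Prop :=
  (forall x, C x -> 0 <= f x) /\
  forall x y (l : R), C x -> C y -> 0 < l < 1 ->
    f x `^ l * f y `^ (1 - l) <= f (l *: x + (1 - l) *: y).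

Definition sort_decr n (x : 'rV[R]_n) : seq R :=
  sort (fun s t => t <= s) [seq x 0 i | i <- enum 'I_n].

Definition majorized n (x y : 'rV[R]_n) : Prop :=
  (forall k, (0 < k < n)%N ->
     \sum_(i < k) (sort_decr x)`_i <= \sum_(i < k) (sort_decr y)`_i) /\
  \sum_(i < n) (sort_decr x)`_i = \sum_(i < n) (sort_decr y)`_i.

Definition schur_concave_on n (D : set 'rV[R]_n) (f : 'rV[R]_n -> R) : Prop :=
  forall x y, D x -> D y -> majorized x y -> f y <= f x.

Definition orthant n : set 'rV[R]_n := [set a | forall i, 0 <= a 0 i].

End convexity.

(* Hfun q mu h a depends only on the L^2 class of h when a != 0, since the sum
   then has a bounded density, whereas Hfun q mu h 0 = h 0 depends on the
   representative. The value at 0 that the class determines is singled out by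
   [lebesgue_pt h 0], which holds in particular if h is continuous at 0. *)
Definition Hfun (R : realType) (q : R) (n : nat)
    (mu : probability (measurableTypeR R) R) (h : R -> R) (a : 'rV[R]_n) : R :=
  \int[power_probability mu n]_x h (\sum_(i < n) a 0 i `^ q^-1 * tnth x i).

(* Main.v *)
From HB Require Import structures.
Require Import Defs.
From mathcomp Require Import all_boot all_order all_algebra.
From mathcomp Require Import all_classical all_reals all_analysis.
From mathcomp Require Import measurable_realfun.
From mathcomp Require Import ring lra.

(** Write [g s] for the Fourier transform of [phi] at [s `^ q^-1]. Let [S] be the sum of
    the [a_i `^ q^-1 * X_i], where the [X_i] are independent of law [mu]. The real
    characteristic function of [S] at [t] is the product of the [g (a_i * `|t| `^ q)].
    Parseval's formula gives, for [a <> 0],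

      c * H a = \int rho(t) * \prod_i g (a_i * `|t| `^ q) dt,

    where [rho >= 0] is the positive part of [Re hhat] (almost everywhere equal to
    [hhat]) and [c > 0] is the integral of the Fejer kernel. Its value is 1, but only its
    positivity matters, because both conclusions are insensitive to a constant
    factor. See [Hfun_representation].

    For (i), the product is log-convex in [a], and Hoelder's inequality
    ([Rintegral_geometric_le]) transfers log-convexity to the integral. For (ii),
    [ln \o g] is concave where [g > 0], so that Karamata's inequality ([karamata]) makes
    the product Schur concave for each [t] ([prod_schur]).

    Parseval's formula must be established for a function [h] which is only in L^2, against
    the law [nu] of [S], whose characteristic function [C] is integrable. Averaging the
    Fejer kernel against [nu] shows that [nu] of an interval is at most a constant times
    its length ([probability_itv_le]), so [nu] is dominated by a multiple of the
    Lebesgue measure. Smoothing by the Fejer kernel proves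
    [c * \int f dnu = \int C * f^] for bounded functions continuous [nu]-almost
    everywhere ([inversion_ae_continuous]); density of the truncated continuous
    functions extends it to L^1 ([inversion_L1]), and the domination together with
    Cauchy-Schwarz carries it to L^2 ([inversion_L2]).

    At [a = 0] one has [H 0 = h 0]. Applying the formula to the law with triangular
    density at scale [r], and letting [r] tend to 0, the left-hand side tends to
    [c * h 0] because 0 is a Lebesgue point, and Fatou's lemma gives
    [\int rho <= c * h 0] ([lebesgue_pt_origin]). This inequality suffices, since the
    value at 0 occurs only in the upper bound of the log-convexity inequality. *)

Set Implicit Arguments.
Unset Strict Implicit.
Unset Printing Implicit Defensive.
Import Order.TTheory GRing.Theory Num.Theory.
Import numFieldNormedType.Exports.
Import ComplexField.Normc.
Local Open Scope classical_set_scope.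
Local Open Scope ring_scope.

(** * Integrals of real-valued functions *)

(** Integrability over the whole space of a real-valued function. *)
Notation Rintegrable m f := (m.-integrable [set: _] (EFin \o f)).

Section real_integral.
Context d (T : measurableType d) (R : realType) (m : {measure set T -> \bar R}).
Implicit Types f g b : T -> R.

Lemma Rintegrable_measurable f : Rintegrable m f -> measurable_fun [set: T] f.
Proof. by move=> /measurable_int/measurable_EFinP. Qed.

Lemma le_Rintegrable f g : measurable_fun [set: T] f ->
  (forall x, `|f x| <= g x) -> Rintegrable m g -> Rintegrable m f.
Proof.
move=> mf fg; apply: le_integrable => //; first exact/measurable_EFinP.
move=> x _ /=; rewrite lee_fin (le_trans (fg x))//.
by rewrite ler_norm.
Qed.

Lemma RintegrableZl (r : R) f : Rintegrable m f ->
  Rintegrable m (fun x => r * f x).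
Proof.
move=> fi; have := integrableZl measurableT r fi.
by under eq_fun do rewrite /= -EFinM.
Qed.

Lemma RintegrableB f g : Rintegrable m f -> Rintegrable m g ->
  Rintegrable m (fun x => f x - g x).
Proof.
move=> fi gi; have := integrableB measurableT fi gi.
by under eq_fun do rewrite /= -EFinB.
Qed.

Lemma Rintegrable_norm f : Rintegrable m f -> Rintegrable m (fun x => `|f x|).
Proof. exact: integrable_norm. Qed.

Lemma RintegrableM_bounded f b M : Rintegrable m f ->
  measurable_fun [set: T] b -> (forall x, `|b x| <= M) ->
  Rintegrable m (fun x => f x * b x).
Proof.
move=> fi mb bM.
apply: (@le_Rintegrable _ (fun x => M * `|f x|)).
- by apply: measurable_funM => //; exact: Rintegrable_measurable fi.
- by move=> x; rewrite normrM mulrC ler_wpM2r.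
- have := integrableZl (measurableT) M (integrable_norm fi).
  by under eq_fun do rewrite /= -EFinM.
Qed.

Lemma Rintegral_dominated_cvg (f_ : nat -> T -> R) f g :
  (forall n, measurable_fun [set: T] (f_ n)) -> measurable_fun [set: T] f ->
  {ae m, forall x, f_ n x @[n --> \oo] --> f x} ->
  (forall n x, `|f_ n x| <= g x) -> Rintegrable m g ->
  \int[m]_x f_ n x @[n --> \oo] --> \int[m]_x f x.
Proof.
move=> mf_ mf ff fg gi.
have [] := @dominated_convergence _ _ _ m setT measurableT
  (fun n x => (f_ n x)%:E) (EFin \o f) (EFin \o g).
- by move=> n; exact/measurable_EFinP.
- exact/measurable_EFinP.
- apply: filterS ff => x fx _; by apply/cvg_EFin => //; exact: nearW.
- exact: gi.
- by apply: aeW => x n _ /=; rewrite lee_fin.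
- move=> fi _ cv; apply: fine_cvg; rewrite fineK//.
  exact: integrable_fin_num.
Qed.

End real_integral.

Section real_fubini.
Context d1 d2 (T1 : measurableType d1) (T2 : measurableType d2) (R : realType).
Variables (m1 : {sigma_finite_measure set T1 -> \bar R}).
Variables (m2 : {sigma_finite_measure set T2 -> \bar R}).
Local Open Scope ereal_scope.

(** A product of functions of separate variables is integrable on the product space. *)
Lemma Rintegrable_prod (f : T1 -> R) (g : T2 -> R) :
  Rintegrable m1 f -> Rintegrable m2 g ->
  Rintegrable (m1 \x m2) (fun z => f z.1 * g z.2)%R.
Proof.
move=> fi gi.
have mf := Rintegrable_measurable fi.
have mg := Rintegrable_measurable gi.
apply/integrable12ltyP.
  apply/measurable_EFinP; apply: measurable_funM.
    exact: measurableT_comp mf measurable_fst.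
  exact: measurableT_comp mg measurable_snd.
under eq_integral => x _.
  under eq_integral => y _ do rewrite /= normrM EFinM.
  rewrite ge0_integralZl//; last first.
    by apply/measurable_EFinP; exact: measurableT_comp.
  over.
rewrite ge0_integralZr//; last 2 first.
- by apply/measurable_EFinP; exact: measurableT_comp.
- by apply: integral_ge0 => y _; rewrite lee_fin.
case/integrableP : fi => _ fi; case/integrableP : gi => _ gi.
by rewrite lte_mul_pinfty// ?integral_ge0// ge0_fin_numE// integral_ge0.
Qed.

(** The inner integral is finite only almost everywhere; elsewhere,
    [Rintegral] takes the value 0, which does not affect the outer integral. *)
Lemma Rfubini_integrable (f : T1 * T2 -> R) : Rintegrable (m1 \x m2) f ->
  Rintegrable m1 (fun x => \int[m2]_y f (x, y))%R /\
  \int[m1]_x (\int[m2]_y f (x, y))%R%:E = \int[m1 \x m2]_z (f z)%:E.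
Proof.
move=> fi.
have Fi := integrable_fubini_F fi.
have mF := measurable_int _ Fi.
have mF' : measurable_fun setT (fun x => (\int[m2]_y f (x, y))%R).
  by apply: measurableT_comp mF.
have aeF : ae_eq m1 setT (fubini_F m2 (EFin \o f))
    (EFin \o (fun x => (\int[m2]_y f (x, y))%R)).
  have := integrable_ae measurableT Fi.
  apply: filterS => x /(_ I) Ffin _ /=.
  by rewrite /Rintegral fineK.
split.
  apply/integrableP; split; first exact/measurable_EFinP.
  case/integrableP : Fi => _; apply: le_lt_trans.
  rewrite le_eqVlt; apply/orP; left; apply/eqP.
  apply: ge0_ae_eq_integral => //.
  - by apply: measurableT_comp => //; exact/measurable_EFinP.
  - exact: measurableT_comp.
  - by apply: filterS aeF => x /(_ I) + _ => ->.
rewrite -integral12_prod_meas1//.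
apply: ae_eq_integral => //; first exact/measurable_EFinP.
by apply: filterS aeF => x /(_ I) + _ => ->.
Qed.

Lemma Rfubini_integrable2 (f : T1 * T2 -> R) : Rintegrable (m1 \x m2) f ->
  Rintegrable m2 (fun y => \int[m1]_x f (x, y))%R /\
  \int[m2]_y (\int[m1]_x f (x, y))%R%:E = \int[m1 \x m2]_z (f z)%:E.
Proof.
move=> fi.
have Fi : m2.-integrable setT (fubini_G m1 (EFin \o f)).
  apply/integrableP; split; first exact: (measurable_fubini_G fi).
  have mf := measurable_int _ fi.
  apply: le_lt_trans ((integrable21ltyP _ _ mf).1 fi).
  apply: ge0_le_integral => //.
  - by apply: measurableT_comp => //; exact: (measurable_fubini_G fi).
  - apply: (@measurable_fun_fubini_tonelli_G _ _ _ _ _ m1 (abse \o (EFin \o f))).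
      exact: measurableT_comp.
    by move=> z; exact: abse_ge0.
  - move=> y _; apply: le_abse_integral => //.
    exact: measurableT_comp mf (measurable_pair2 y).
have mF := measurable_int _ Fi.
have mF' : measurable_fun setT (fun x => (\int[m1]_y f (y, x))%R).
  by apply: measurableT_comp mF.
have aeF : ae_eq m2 setT (fubini_G m1 (EFin \o f))
    (EFin \o (fun x => (\int[m1]_y f (y, x))%R)).
  have := integrable_ae measurableT Fi.
  apply: filterS => x /(_ I) Ffin _ /=.
  by rewrite /Rintegral fineK.
split.
  apply/integrableP; split; first exact/measurable_EFinP.
  case/integrableP : Fi => _; apply: le_lt_trans.
  rewrite le_eqVlt; apply/orP; left; apply/eqP.
  apply: ge0_ae_eq_integral => //.
  - by apply: measurableT_comp => //; exact/measurable_EFinP.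
  - exact: measurableT_comp.
  - by apply: filterS aeF => x /(_ I) + _ => ->.
rewrite -integral21_prod_meas1//.
apply: ae_eq_integral => //; first exact/measurable_EFinP.
by apply: filterS aeF => x /(_ I) + _ => ->.
Qed.

(** Fubini's theorem in the form used below: a product of integrable functions
    times a bounded kernel [b]. *)
Lemma Rfubini (f : T1 -> R) (g : T2 -> R) (b : T1 * T2 -> R) (M : R) :
  Rintegrable m1 f -> Rintegrable m2 g ->
  measurable_fun setT b -> (forall z, (`|b z| <= M)%R) ->
  [/\ Rintegrable m1 (fun x => \int[m2]_y (f x * g y * b (x, y)))%R,
      Rintegrable m2 (fun y => \int[m1]_x (f x * g y * b (x, y)))%R &
  (\int[m1]_x \int[m2]_y (f x * g y * b (x, y)) =
   \int[m2]_y \int[m1]_x (f x * g y * b (x, y)))%R].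
Proof.
move=> fi gi mb bM.
have fgb := RintegrableM_bounded (Rintegrable_prod fi gi) mb bM.
have [i1 e1] := Rfubini_integrable fgb.
have [i2 e2] := Rfubini_integrable2 fgb.
split => //.
by rewrite /Rintegral /= in e1 e2 *; rewrite e1 e2.
Qed.

End real_fubini.

(** * Affine change of variable for the Lebesgue measure *)

Section lebesgue_affine.
Context (R : realType).
Local Notation leb := (@lebesgue_measure R).
Variables (a b : R).
Hypothesis a0 : 0 < a.

Definition affine (y : R) : R := a * y + b.

Lemma measurable_affine : measurable_fun [set: measurableTypeR R] (affine : _ -> measurableTypeR R).
Proof. by apply: measurable_funD => //; exact: measurable_funM. Qed.

Let nna : {nonneg R} := NngNum (ltW a0).

Let affine_measure : {measure set (measurableTypeR R) -> \bar R} :=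
  mscale nna (measure_function_pushforward__canonical__measure_function_Measure
    leb measurable_affine).

Let lebesgue_measure_affine (A : set (measurableTypeR R)) : measurable A ->
  leb A = affine_measure A.
Proof.
move: A; apply: lebesgue_measure_unique => _ [[x y]] _ <- /=.
rewrite /affine_measure/= /mscale/= /pushforward.
have -> : affine @^-1` `]x, y]%classic = `](x - b) / a, (y - b) / a]%classic.
  apply/seteqP; split => z /=; rewrite !in_itv/= /affine;
  by rewrite ltr_pdivrMr// ler_pdivlMr// mulrC ltrBlDr lerBrDr mulrC.
rewrite lebesgue_measure_itv/= lebesgue_measure_itv/= !lte_fin.
rewrite ltr_pM2r ?invr_gt0// ltrD2r.
case: ifPn => // xy; last by rewrite mule0.
by rewrite -!EFinD -EFinM -mulrBl mulrCA divff ?gt_eqF// mulr1; congr EFin; ring.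
Qed.

Lemma ge0_integral_affine (f : R -> \bar R) : measurable_fun [set: R] f ->
  (forall x, (0 <= f x)%E) ->
  (\int[leb]_x f x = a%:E * \int[leb]_x f (affine x))%E.
Proof.
move=> mf f0.
rewrite (@eq_measure_integral _ _ _ setT affine_measure leb); last first.
  by move=> A mA _; exact: lebesgue_measure_affine.
rewrite ge0_integral_mscale//=.
by rewrite ge0_integral_pushforward//; exact: measurable_affine.
Qed.

Lemma Rintegrable_affine (f : R -> R) :
  Rintegrable leb f -> Rintegrable leb (f \o affine).
Proof.
move=> /integrableP[mf fi]; apply/integrableP; split.
  by apply/measurable_EFinP; apply: measurableT_comp measurable_affine; exact/measurable_EFinP.
move: fi; rewrite ge0_integral_affine//; last exact: measurableT_comp.
rewrite !ltey; apply: contraNN => /eqP /= ->.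
by rewrite gt0_muley ?lte_fin.
Qed.

Lemma Rintegral_affine (f : R -> R) : Rintegrable leb f ->
  \int[leb]_x f x = a * \int[leb]_x f (affine x).
Proof.
move=> fi.
have mf : measurable_fun [set: R] (EFin \o f) := measurable_int _ fi.
have fai := Rintegrable_affine fi.
have p : (\int[leb]_x (EFin \o f)^\+ x =
          a%:E * \int[leb]_x (EFin \o (f \o affine))^\+ x)%E.
  rewrite (ge0_integral_affine (measurable_funepos mf) (funepos_ge0 _)).
  by congr *%E; apply: eq_integral => x _; rewrite !funeposE.
have n : (\int[leb]_x (EFin \o f)^\- x =
          a%:E * \int[leb]_x (EFin \o (f \o affine))^\- x)%E.
  rewrite (ge0_integral_affine (measurable_funeneg mf) (funeneg_ge0 _)).
  by congr *%E; apply: eq_integral => x _; rewrite !funenegE.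
have e : (\int[leb]_x (EFin \o f) x = a%:E * \int[leb]_x (EFin \o (f \o affine)) x)%E.
  rewrite integralE p n -muleBr//; first by rewrite [in RHS]integralE.
  exact: (integrable_add_def measurableT fai).
rewrite /Rintegral e.
by rewrite fineM//; exact: integrable_fin_num.
Qed.

End lebesgue_affine.

(** * Densities *)

Section density.
Context (R : realType).
Local Notation leb := (@lebesgue_measure R).
Variables (P : probability (measurableTypeR R) R) (phi : R -> R).
Hypothesis P_phi : is_density P phi.

(** The density coincides almost everywhere with the Radon-Nikodym derivative. *)
Lemma Rintegral_density (f : R -> R) : Rintegrable P f ->
  \int[P]_x f x = \int[leb]_x (f x * phi x).
Proof.
move=> fi; have [mphi phi0 PE] := P_phi.
have dom : P `<< leb.
  apply/null_content_dominatesP => A mA A0.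
  rewrite PE// null_set_integral//.
  exact/measurable_EFinP/measurable_funTS.
have mf := measurable_int _ fi.
rewrite /Rintegral -(Radon_Nikodym_change_of_variables dom)//.
congr fine; apply: ae_eq_integral => //.
- exact: emeasurable_funM.
- apply/measurable_EFinP; apply: measurable_funM => //.
  exact/measurable_EFinP.
- have : ae_eq leb setT (Radon_Nikodym (charge_of_finite_measure P) leb) (EFin \o phi).
    apply: integral_ae_eq => //.
    + exact: Radon_Nikodym_integrable.
    + exact/measurable_EFinP.
    + by move=> E _ mE; rewrite -Radon_Nikodym_integral//= PE.
  by apply: filterS => x /(_ I) e _; rewrite e.
Qed.

End density.

(** * Cosine transform *)

Section cosine_transform.
Context (R : realType).
Local Notation leb := (@lebesgue_measure R).
Implicit Types (m : {measure set (measurableTypeR R) -> \bar R}) (f : R -> R).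

(** The cosine transform of [f] with respect to [m]. For the Lebesgue measure it is the
    real part of [fourier f]. *)
Definition costr m f (x : R) : R := \int[m]_y (f y * cos (2 * pi * x * y)).
Lemma measurable_cos : measurable_fun [set: R] (@cos R).
Proof. by apply: continuous_measurable_fun; exact: continuous_cos. Qed.

Lemma measurable_sin : measurable_fun [set: R] (@sin R).
Proof. by apply: continuous_measurable_fun; exact: continuous_sin. Qed.

Lemma measurable_cosM (a : R) : measurable_fun [set: R] (fun y => cos (a * y)).
Proof.
apply: measurableT_comp measurable_cos _.
exact: measurable_funM.
Qed.

Lemma measurable_sinM (a : R) : measurable_fun [set: R] (fun y => sin (a * y)).
Proof.
apply: measurableT_comp measurable_sin _.
exact: measurable_funM.
Qed.

Lemma Rintegrable_cosM m f a : Rintegrable m f ->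
  Rintegrable m (fun y => f y * cos (a * y)).
Proof.
move=> fi; apply: (RintegrableM_bounded fi (measurable_cosM a)) => x.
exact: cos_max.
Qed.

Lemma costrN m f x : costr m f (- x) = costr m f x.
Proof.
by apply: eq_Rintegral => y _; rewrite mulrN mulNr cosN.
Qed.

Lemma le_costr m f x : Rintegrable m f ->
  `|costr m f x| <= \int[m]_y `|f y|.
Proof.
move=> fi.
have ci := Rintegrable_cosM (2 * pi * x) fi.
apply: le_trans (le_normr_Rintegral measurableT ci) _.
apply: le_Rintegral => //.
- exact: integrable_norm ci.
- exact: integrable_norm fi.
- by move=> y _; rewrite normrM ler_piMr// cos_max.
Qed.

Lemma continuous_costr m f : Rintegrable m f -> continuous (costr m f).
Proof.
move=> fi x; apply/(@cvg_nbhsP _ R^o) => w wx.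
apply: (@Rintegral_dominated_cvg _ _ _ m (fun n y => f y * cos (2 * pi * w n * y))
  (fun y => f y * cos (2 * pi * x * y)) (fun y => `|f y|)).
- by move=> n; exact: Rintegrable_measurable (Rintegrable_cosM _ fi).
- exact: Rintegrable_measurable (Rintegrable_cosM _ fi).
- apply: aeW => y; apply: cvgMr.
  apply: (@continuous_cvg _ _ _ _ _ _ (@cos R)); first exact: continuous_cos.
  by apply: cvgMl; apply: cvgMr.
- by move=> n y; rewrite normrM ler_piMr// cos_max.
- exact: integrable_norm fi.
Qed.

Lemma measurable_costr m f : Rintegrable m f -> measurable_fun [set: R] (costr m f).
Proof.
by move=> fi; apply: continuous_measurable_fun; exact: continuous_costr.
Qed.

End cosine_transform.

(** * The triangle function and the Fejer kernel *)

Section triangle.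
Context (R : realType).
Local Notation leb := (@lebesgue_measure R).

(** The tent function, supported by the interval from -1 to 1. Its cosine transform is
    the Fejer kernel, which is nonnegative and integrable. *)
Definition triangle (t : R) : R := Num.max 0 (1 - `|t|).

Lemma triangle_ge0 t : 0 <= triangle t.
Proof. by rewrite le_max lexx. Qed.

Lemma triangle_le1 t : triangle t <= 1.
Proof. by rewrite ge_max ler01 lerBlDr lerDl normr_ge0. Qed.

Lemma triangle0 : triangle 0 = 1.
Proof. by rewrite /triangle normr0 subr0 max_r. Qed.

Lemma triangle_out t : 1 <= `|t| -> triangle t = 0.
Proof. by move=> t1; rewrite /triangle max_l// subr_le0. Qed.

Lemma continuous_triangle : continuous triangle.
Proof.
move=> x; apply: (@continuous_max _ _ (cst 0) (fun t : R => 1 - `|t|)).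
  exact: cvg_cst.
by apply: cvgB; [exact: cvg_cst|exact: norm_continuous].
Qed.

Lemma measurable_triangle : measurable_fun [set: R] triangle.
Proof. by apply: continuous_measurable_fun; exact: continuous_triangle. Qed.

Lemma Rintegrable_triangle : Rintegrable leb triangle.
Proof.
apply: (@le_Rintegrable _ (measurableTypeR R) R leb triangle
  (\1_(`[-1, 1]%classic : set R))).
- exact: measurable_triangle.
- move=> x; rewrite ger0_norm ?triangle_ge0// indicE.
  case: (boolP (x \in _)) => [_|]; first exact: triangle_le1.
  rewrite notin_setE/= in_itv/= -ler_norml => /negP; rewrite -ltNge => x1.
  by rewrite triangle_out// ltW.
- exact: integrable_indic_itv.
Qed.

Lemma Rintegral_triangle (g : R -> R) : continuous g ->
  \int[leb]_t (triangle t * g t) =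
  \int[leb]_(t in `[-1, 0]) ((1 + t) * g t) + \int[leb]_(t in `[0, 1]) ((1 - t) * g t).
Proof.
move=> cg.
have cint (f : R -> R) a b : continuous f -> leb.-integrable `[a, b] (EFin \o f).
  move=> cf; apply: continuous_compact_integrable; first exact: segment_compact.
  exact: continuous_subspaceT.
have ctg : continuous (fun t => triangle t * g t).
  by move=> x; apply: cvgM; [exact: continuous_triangle|exact: cg].
have c1 : continuous (fun t : R => (1 + t) * g t).
  by move=> x; apply: cvgM; [apply: cvgD; [exact: cvg_cst|exact: cvg_id]|exact: cg].
have c2 : continuous (fun t : R => (1 - t) * g t).
  by move=> x; apply: cvgM; [apply: cvgB; [exact: cvg_cst|exact: cvg_id]|exact: cg].
transitivity (\int[leb]_(t in `[-1, 1]) (triangle t * g t)).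
  rewrite [RHS]Rintegral_mkcond; apply: eq_Rintegral => x _.
  rewrite patchE; case: ifPn => //.
  rewrite notin_setE/= in_itv/= -ler_norml => /negP; rewrite -ltNge => x1.
  by rewrite triangle_out ?mul0r// ltW.
have := @Rintegral_itvB _ _ (BLeft (-1)) (BRight 1) 0 (cint _ (-1) 1 ctg).
rewrite !bnd_simp lerN10 ler01 => /(_ isT isT) /eqP; rewrite subr_eq addrC => /eqP ->.
rewrite Rintegral_itv_obnd_cbnd; last first.
  apply: integrableS (cint _ 0 1 ctg) => //; exact: subset_itv_oc_cc.
congr (_ + _); apply: eq_Rintegral => x; rewrite inE/= in_itv/= => /andP[x0 x1].
  by rewrite /triangle ler0_norm// opprK max_r// -lerBlDl sub0r.
by rewrite /triangle ger0_norm// max_r// subr_ge0.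
Qed.

Lemma is_derive_sinM (b x : R) : is_derive x 1 (fun t => sin (b * t)) (b * cos (b * x)).
Proof.
have h : is_derive x 1 (fun t => b * t) b.
  by apply: is_derive_eq; rewrite /GRing.scale/= mulr1 ?mulr0 ?addr0.
have := is_derive1_comp (is_derive_sin (b * x)) h.
by rewrite mulrC.
Qed.

Lemma is_derive_cosM (b x : R) : is_derive x 1 (fun t => cos (b * t)) (- (b * sin (b * x))).
Proof.
have h : is_derive x 1 (fun t => b * t) b.
  by apply: is_derive_eq; rewrite /GRing.scale/= mulr1 ?mulr0 ?addr0.
have := is_derive1_comp (is_derive_cos (b * x)) h.
by rewrite mulNr mulrC.
Qed.

Lemma continuous_FTC (f F : R -> R) (a b : R) : a < b -> continuous f ->
  (forall x : R, is_derive x (1 : R) F (f x)) ->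
  \int[leb]_(x in `[a, b]) f x = F b - F a.
Proof.
move=> ab cf dF; rewrite /Rintegral (@continuous_FTC2 _ f F a b)//.
- exact: continuous_subspaceT.
- have cF x : {for x, continuous F}.
    by apply/differentiable_continuous/derivable1_diffP; case: (dF x).
  split.
  + by move=> x _; case: (dF x).
  + by apply: cvg_at_right_filter; exact: cF.
  + by apply: cvg_at_left_filter; exact: cF.
- by move=> x _; rewrite derive1E; case: (dF x).
Qed.

Lemma costr_triangle0 : costr leb triangle 0 = 1.
Proof.
have c1 : continuous (fun _ : R => 1 : R) by move=> x; exact: cvg_cst.
rewrite /costr; under eq_Rintegral do rewrite mulr0 mul0r cos0.
rewrite (Rintegral_triangle c1).
under [X in X + _]eq_Rintegral do rewrite mulr1.
under [X in _ + X]eq_Rintegral do rewrite mulr1.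
have d1 (x : R) : is_derive x (1 : R) (fun t => t + t * t / 2) (1 + x).
  by apply: is_derive_eq; rewrite /GRing.scale/=; field.
have d2 (x : R) : is_derive x (1 : R) (fun t => t - t * t / 2) (1 - x).
  by apply: is_derive_eq; rewrite /GRing.scale/=; field.
have k1 : continuous (fun t : R => 1 + t).
  by move=> x; apply: cvgD; [exact: cvg_cst|exact: cvg_id].
have k2 : continuous (fun t : R => 1 - t).
  by move=> x; apply: cvgB; [exact: cvg_cst|exact: cvg_id].
rewrite (continuous_FTC (ltrN10 R) k1 d1) (continuous_FTC ltr01 k2 d2).
by field.
Qed.

Lemma costr_triangle z : z != 0 ->
  costr leb triangle z = 2 * (1 - cos (2 * pi * z)) / (2 * pi * z) ^+ 2.
Proof.
move=> z0; set b := 2 * pi * z.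
have b0 : b != 0 by rewrite !mulf_neq0// gt_eqF// pi_gt0.
have cc : continuous (fun t : R => cos (b * t)).
  move=> x; apply: (@continuous_cvg _ _ _ _ _ _ (@cos R)); first exact: continuous_cos.
  by apply: cvgM; [exact: cvg_cst|exact: cvg_id].
rewrite /costr (Rintegral_triangle cc).
have ds := is_derive_sinM b; have dc := is_derive_cosM b.
have d1 (x : R) : is_derive x (1 : R)
    (fun t => (1 + t) * (sin (b * t) / b) + cos (b * t) / b ^+ 2)
    ((1 + x) * cos (b * x)).
  by apply: is_derive_eq; rewrite /GRing.scale/=; field.
have d2 (x : R) : is_derive x (1 : R)
    (fun t => (1 - t) * (sin (b * t) / b) - cos (b * t) / b ^+ 2)
    ((1 - x) * cos (b * x)).
  by apply: is_derive_eq; rewrite /GRing.scale/=; field.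
have k1 : continuous (fun t : R => (1 + t) * cos (b * t)).
  by move=> x; apply: cvgM; [apply: cvgD; [exact: cvg_cst|exact: cvg_id]|exact: cc].
have k2 : continuous (fun t : R => (1 - t) * cos (b * t)).
  by move=> x; apply: cvgM; [apply: cvgB; [exact: cvg_cst|exact: cvg_id]|exact: cc].
rewrite (continuous_FTC (ltrN10 R) k1 d1) (continuous_FTC ltr01 k2 d2).
by rewrite !mulr0 !mulr1 mulrN mulr1 cosN sinN cos0 sin0; field.
Qed.

End triangle.

Section triangle_transform.
Context (R : realType).
Local Notation leb := (@lebesgue_measure R).
Local Notation P := (costr leb (@triangle R)).

Lemma Rintegral_triangle1 : \int[leb]_t triangle t = 1.
Proof.
rewrite -(costr_triangle0 R); apply: eq_Rintegral => t _.
by rewrite mulr0 mul0r cos0 mulr1.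
Qed.

Lemma costr_triangle_ge0 z : 0 <= P z.
Proof.
have [->|z0] := eqVneq z 0; first by rewrite costr_triangle0.
by rewrite costr_triangle// divr_ge0 ?sqr_ge0// mulr_ge0// subr_ge0 cos_le1.
Qed.

Lemma costr_triangle_le1 z : P z <= 1.
Proof.
rewrite -Rintegral_triangle1; apply: le_trans (ler_norm _) _.
apply: le_trans (le_costr _ (@Rintegrable_triangle R)) _.
by under eq_Rintegral do rewrite ger0_norm ?triangle_ge0//.
Qed.

(** The majorant is integrable: it is twice the derivative of [atan]. *)
Lemma costr_triangle_le z : P z <= 2 / (1 + z ^+ 2).
Proof.
have z2 : 0 <= z ^+ 2 by exact: sqr_ge0.
rewrite ler_pdivlMr; last by lra.
have [z1|z1] := lerP (z ^+ 2) 1.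
  have := costr_triangle_le1 z; have := costr_triangle_ge0 z; nra.
have z0 : z != 0 by apply: contraTneq z1 => ->; rewrite expr0n/= -leNgt.
have pi2 := pi_ge2 R.
rewrite costr_triangle// mulrAC ler_pdivrMr; last first.
  by rewrite exprn_even_gt0//= !mulf_neq0// ?pnatr_eq0// gt_eqF// pi_gt0.
have := cos_geN1 (2 * pi * z); set c := cos _ => c1.
have h : 4 * (1 + z ^+ 2) <= 2 * (2 * pi * z) ^+ 2.
  have p2 : 4 <= pi ^+ 2 :> R by rewrite expr2; nra.
  have : 4 * z ^+ 2 <= pi ^+ 2 * z ^+ 2 by rewrite ler_wpM2r.
  rewrite !exprMn -[2 ^+ 2]/(2 * 2); lra.
apply: le_trans h; by rewrite ler_wpM2r//; lra.
Qed.

Lemma measurable_costr_triangle : measurable_fun [set: R] P.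
Proof. exact: measurable_costr (@Rintegrable_triangle R). Qed.

Lemma Rintegrable_costr_triangle : Rintegrable leb P.
Proof.
apply: (@le_Rintegrable _ (measurableTypeR R) R leb _ (fun z => 2 * (oneDsqr z)^-1)).
- exact: measurable_costr_triangle.
- by move=> z; rewrite ger0_norm ?costr_triangle_ge0// costr_triangle_le.
- have mo : measurable_fun [set: R] (fun z : R => (oneDsqr z)^-1).
    by apply: continuous_measurable_fun; exact: continuous_oneDsqrV.
  apply/integrableP; split; first by apply/measurable_EFinP; exact: measurable_funM.
  under eq_integral do rewrite /= ger0_norm ?mulr_ge0 ?invr_ge0// ?(le_trans ler01 (oneDsqr_ge1 _))// EFinM.
  rewrite ge0_integralZl//; last exact/measurable_EFinP.
  rewrite ge0_symfun_integralT//.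
  - by rewrite -set_itvcy integral0y_oneDsqr !lte_mul_pinfty// ltry.
  - exact: continuous_oneDsqrV.
  - by move=> z /=; rewrite /oneDsqr sqrrN.
Qed.

Lemma cos1_le_cos (u : R) : `|u| <= 1 -> cos 1 <= cos u.
Proof.
rewrite -(cos_norm u) le_eqVlt => /predU1P[->//|u1].
have pi2 := pi_ge2 R.
rewrite ltW// ltr_cos// in_itv/= ?normr_ge0/=; lra.
Qed.

(** On the support of the triangle the cosine stays above [cos 1]. *)
Lemma costr_triangle_lb z : `|2 * pi * z| <= 1 -> cos 1 <= P z.
Proof.
move=> z1; rewrite -[leLHS]mulr1 -[X in _ * X]Rintegral_triangle1 -RintegralZl//; last first.
  exact: Rintegrable_triangle.
apply: le_Rintegral => //.
- exact: (RintegrableZl _ (@Rintegrable_triangle R)).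
- exact: Rintegrable_cosM (@Rintegrable_triangle R).
- move=> t _; have [t1|t1] := lerP 1 `|t|.
    by rewrite triangle_out// mulr0 mul0r.
  rewrite mulrC ler_wpM2l ?triangle_ge0//. apply: cos1_le_cos.
  by rewrite normrM mulr_ile1// ltW.
Qed.

Lemma Rintegral_costr_triangle_gt0 : 0 < \int[leb]_z P z.
Proof.
pose r : R := (2 * pi)^-1.
have r0 : 0 < r by rewrite invr_gt0 mulr_gt0// pi_gt0.
have : \int[leb]_z (cos 1 * \1_(`[-r, r]%classic : set R) z) <= \int[leb]_z P z.
  apply: le_Rintegral => //.
  - exact: (RintegrableZl _ (integrable_indic_itv (-r) r true false)).
  - exact: Rintegrable_costr_triangle.
  - move=> z _; rewrite indicE; case: (boolP (z \in _)) => [|_]; last first.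
      by rewrite mulr0 costr_triangle_ge0.
    rewrite inE/= in_itv/= -ler_norml => zr; rewrite mulr1.
    apply: costr_triangle_lb; rewrite normrM gtr0_norm ?mulr_gt0// ?pi_gt0//.
    by rewrite mulrC -ler_pdivlMr ?mulr_gt0// ?pi_gt0// mul1r.
apply: lt_le_trans; rewrite RintegralZl//; last exact: integrable_indic_itv.
rewrite mulr_gt0 ?cos1_gt0// /Rintegral integral_indic//= setIT.
rewrite [X in fine X](lebesgue_measure_itv `[(- r)%R, r])/=.
by rewrite lte_fin gtrN// -EFinD/= opprK addr_gt0.
Qed.

End triangle_transform.

(** * Measures dominated by a multiple of the Lebesgue measure *)

Section measure_comparison.
Context d (T : measurableType d) (R : realType).
Variables (m1 m2 : {measure set T -> \bar R}).
Import HBNNSimple.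
Hypothesis m12 : forall A, measurable A -> (m1 A <= m2 A)%E.

Lemma ge0_integral_le_measure (f : T -> \bar R) : (forall x, 0 <= f x)%E ->
  (\int[m1]_x f x <= \int[m2]_x f x)%E.
Proof.
move=> f0; rewrite !ge0_integralTE//.
apply: ge_ereal_sup => _ [h hf <-].
apply: (@le_trans _ _ (sintegral m2 h)); last first.
  by apply: ereal_sup_ubound; exists h.
rewrite !sintegralE; apply: lee_fsum => // r [x _ <-].
by rewrite lee_wpmul2l ?lee_fin//; exact: m12.
Qed.

End measure_comparison.

Section lebesgue_comparison.
Context (R : realType).
Local Notation leb := (@lebesgue_measure R).
Variables (nu : {measure set (measurableTypeR R) -> \bar R}) (M : R).
Hypothesis M0 : 0 < M.
Hypothesis nuM : forall a b : R, a < b -> (nu `]a, b]%classic <= (M * (b - a))%:E)%E.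

(** A bound on half-open intervals extends to measurable sets because the Lebesgue
    measure of a set is the infimum of the total length of its interval covers. *)
Lemma le_measure_lebesgue (A : set (measurableTypeR R)) : measurable A ->
  (nu A <= M%:E * leb A)%E.
Proof.
move=> mA.
suff : (M^-1%:E * nu A <= leb A)%E.
  rewrite -(@lee_pmul2l _ M%:E) ?lte_fin//.
  by rewrite muleA -EFinM divff ?gt_eqF// mul1e.
apply: le_ereal_inf_tmp => _ [F [mF AF] <-].
have F_measurable i : measurable (F i : set (measurableTypeR R)).
  exact: sub_sigma_algebra.
apply: (@le_trans _ _ (\sum_(i <oo) M^-1%:E * nu (F i))%E).
  rewrite nneseriesZl//.
  rewrite lee_wpmul2l ?lee_fin ?invr_ge0 ?(ltW M0)//.
  exact: measure_sigma_subadditive.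
apply: lee_nneseries => // i _; first by rewrite mule_ge0 ?lee_fin ?invr_ge0 ?(ltW M0).
have /ocitvP[->|[[a b]/= ab ->]] : ocitv (F i) by exact: mF.
  by rewrite !measure0 mule0.
rewrite wlength_itv/= lte_fin ab -EFinD.
rewrite -(@lee_pmul2l _ M%:E) ?lte_fin// muleA -EFinM divff ?gt_eqF// mul1e.
exact: nuM.
Qed.

Lemma ge0_integral_le_lebesgue (f : R -> \bar R) : measurable_fun [set: R] f ->
  (forall x, 0 <= f x)%E -> (\int[nu]_x f x <= M%:E * \int[leb]_x f x)%E.
Proof.
move=> mf f0; pose k := NngNum (ltW M0).
rewrite -(@ge0_integral_mscale _ _ _ leb setT measurableT k)//.
apply: ge0_integral_le_measure => // A mA.
exact: le_measure_lebesgue.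
Qed.

Lemma lebesgue_Rintegrable_comparison (f : R -> R) :
  Rintegrable leb f -> Rintegrable nu f.
Proof.
move=> /integrableP[mf fi]; apply/integrableP; split => //.
apply: le_lt_trans (ge0_integral_le_lebesgue _ _) _ => //.
  exact: measurableT_comp.
by rewrite lte_mul_pinfty// lee_fin ltW.
Qed.

Lemma le_Rintegral_lebesgue (f : R -> R) : Rintegrable leb f ->
  (forall x, 0 <= f x) -> \int[nu]_x f x <= M * \int[leb]_x f x.
Proof.
move=> fi f0; have mf := measurable_int _ fi.
rewrite -[X in X * _]/(fine M%:E) -fineM//; last exact: (integrable_fin_num measurableT fi).
rewrite fine_le//.
- exact: (integrable_fin_num measurableT (lebesgue_Rintegrable_comparison fi)).
- by rewrite fin_numM//; exact: (integrable_fin_num measurableT fi).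
- exact: ge0_integral_le_lebesgue.
Qed.

Lemma null_dominates_lebesgue : nu `<< leb.
Proof.
apply/null_content_dominatesP => A mA A0; apply/eqP; rewrite eq_le measure_ge0 andbT.
by rewrite (le_trans (le_measure_lebesgue mA))// A0 mule0.
Qed.

End lebesgue_comparison.

(** * Characteristic functions and smoothing by the Fejer kernel *)

Section characteristic.
Context (R : realType).
Local Notation leb := (@lebesgue_measure R).
Implicit Types nu : probability (measurableTypeR R) R.

Lemma probability_Rintegrable d (T : measurableType d) (P : probability T R) (f : T -> R) (M : R) :
  measurable_fun setT f -> (forall x, `|f x| <= M) -> Rintegrable P f.
Proof.
move=> mf fM; apply: (le_Rintegrable mf fM).
exact: (finite_measure_integrable_cst P M measurableT).
Qed.

(** The real part of the characteristic function of [nu], with the normalization of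
    [fourier]. *)
Definition charf nu (t : R) : R := \int[nu]_x cos (2 * pi * t * x).

Lemma charfE nu : charf nu = costr nu (fun=> 1).
Proof. by apply/funext => t; apply: eq_Rintegral => x _; rewrite mul1r. Qed.

Lemma Rintegrable_prob1 nu : Rintegrable nu (fun=> 1 : R).
Proof. exact: finite_measure_integrable_cst. Qed.

Lemma measurable_charf nu : measurable_fun [set: R] (charf nu).
Proof. rewrite charfE; exact: (measurable_costr (Rintegrable_prob1 nu)). Qed.

Lemma Rintegral_prob1 d (T : measurableType d) (P : probability T R) (r : R) :
  \int[P]_x r = r.
Proof. by rewrite Rintegral_cst//= probability_setT mulr1. Qed.

Lemma charf_le1 nu t : `|charf nu t| <= 1.
Proof.
rewrite charfE; apply: le_trans (le_costr t (Rintegrable_prob1 nu)) _.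
by under eq_Rintegral do rewrite normr1; rewrite Rintegral_prob1.
Qed.

Lemma measurable_cos_prod : measurable_fun [set: measurableTypeR R * measurableTypeR R]
  (fun z : measurableTypeR R * measurableTypeR R => cos (2 * pi * z.1 * z.2)).
Proof.
apply: measurableT_comp (@measurable_cos R) _.
by apply: measurable_funM => //; apply: measurable_funM.
Qed.

End characteristic.

Section scaled_kernel.
Context (R : realType).
Local Notation leb := (@lebesgue_measure R).
Local Notation P := (costr leb (@triangle R)).
Variable e : R.
Hypothesis e0 : 0 < e.

(** The Fejer kernel at scale [e], defined as the transform of the dilated triangle. *)
Definition fejer (w : R) : R := costr leb (fun t => triangle (e * t)) w.

Lemma affine0 : affine e 0 = ( *%R e).
Proof. by apply/funext => x; rewrite /affine addr0. Qed.

Lemma Rintegrable_triangleM : Rintegrable leb (fun t => triangle (e * t)).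
Proof.
have := Rintegrable_affine 0 e0 (@Rintegrable_triangle R).
by rewrite affine0.
Qed.

Lemma fejerE w : fejer w = e^-1 * P (w / e).
Proof.
have -> : P (w / e) = e * fejer w.
  rewrite /costr (Rintegral_affine 0 e0); last exact: (Rintegrable_cosM _ (@Rintegrable_triangle R)).
  congr (_ * _); apply: eq_Rintegral => t _.
  rewrite affine0; congr (_ * cos _).
  by field; rewrite gt_eqF.
by rewrite mulKf// gt_eqF.
Qed.

Lemma measurable_fejer : measurable_fun [set: R] fejer.
Proof. exact: (measurable_costr Rintegrable_triangleM). Qed.

Lemma fejer_ge0 w : 0 <= fejer w.
Proof. by rewrite fejerE mulr_ge0 ?invr_ge0 ?(ltW e0)// costr_triangle_ge0. Qed.

Lemma fejer_le w : fejer w <= e^-1.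
Proof. by rewrite fejerE ler_piMr ?invr_ge0 ?(ltW e0)// costr_triangle_le1. Qed.

End scaled_kernel.

Section fejer_average.
Context (R : realType).
Local Notation leb := (@lebesgue_measure R).
Local Notation P := (costr leb (@triangle R)).
Variable nu : probability (measurableTypeR R) R.
Hypothesis nu_sin : forall t, \int[nu]_x sin (2 * pi * t * x) = 0.
Hypothesis Ci : Rintegrable leb (charf nu).

(** The sine integrals vanish by hypothesis, so only the cosine part of the addition
    formula survives. *)
Lemma charf_shift t y :
  \int[nu]_x cos (2 * pi * (x - y) * t) = charf nu t * cos (2 * pi * t * y).
Proof.
have ci : Rintegrable nu (fun x => cos (2 * pi * t * x)).
  apply: (@probability_Rintegrable _ _ _ _ _ 1); first exact: measurable_cosM.
  by move=> x; exact: cos_max.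
have si : Rintegrable nu (fun x => sin (2 * pi * t * x)).
  apply: (@probability_Rintegrable _ _ _ _ _ 1); first exact: measurable_sinM.
  by move=> x; exact: sin_max.
transitivity (\int[nu]_x (cos (2 * pi * t * y) * cos (2 * pi * t * x) +
                          sin (2 * pi * t * y) * sin (2 * pi * t * x))).
  apply: eq_Rintegral => x _.
  rewrite (_ : 2 * pi * (x - y) * t = 2 * pi * t * x - 2 * pi * t * y); last by ring.
  by rewrite cosB mulrC [X in _ + X]mulrC.
rewrite RintegralD//; last 2 first.
- exact: RintegrableZl.
- exact: RintegrableZl.
by rewrite !RintegralZl// nu_sin mulr0 addr0 mulrC.
Qed.

Lemma Rintegral_fejer e y : 0 < e ->
  \int[nu]_x fejer e (x - y) =
  \int[leb]_t (triangle (e * t) * charf nu t * cos (2 * pi * t * y)).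
Proof.
move=> e0.
pose b (z : measurableTypeR R * measurableTypeR R) := cos (2 * pi * (z.1 - y) * z.2).
have mb : measurable_fun setT b.
  apply: measurableT_comp (@measurable_cos R) _.
  apply: measurable_funM => //; apply: measurable_funM => //.
  exact: measurable_funB.
have [_ _] := @Rfubini _ _ _ _ R nu leb (fun=> 1) (fun t => triangle (e * t)) b 1
  (Rintegrable_prob1 nu) (Rintegrable_triangleM e0) mb (fun z => cos_max _).
rewrite /b /= => E.
transitivity (\int[nu]_x \int[leb]_t (1 * triangle (e * t) * cos (2 * pi * (x - y) * t))).
  by apply: eq_Rintegral => x _; apply: eq_Rintegral => t _; rewrite mul1r.
rewrite E; apply: eq_Rintegral => t _.
under eq_Rintegral do rewrite mul1r.
rewrite RintegralZl//; last first.
  apply: (@probability_Rintegrable _ _ _ _ _ 1); last by move=> x; exact: cos_max.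
  apply: measurableT_comp (@measurable_cos R) _.
  apply: measurable_funM => //; apply: measurable_funM => //.
  exact: measurable_funB.
by rewrite charf_shift mulrA.
Qed.

(** The mean of the Fejer kernel under [nu] is bounded uniformly in the scale [e] and
    in the centre [y]. *)
Lemma Rintegral_fejer_le e y : 0 < e ->
  \int[nu]_x fejer e (x - y) <= \int[leb]_t `|charf nu t|.
Proof.
move=> e0; rewrite Rintegral_fejer//.
have i1 : Rintegrable leb (fun t => triangle (e * t) * charf nu t * cos (2 * pi * t * y)).
  apply: (le_Rintegrable _ _ (Rintegrable_norm Ci)).
    apply: measurable_funM.
      apply: measurable_funM; last exact: measurable_charf.
      exact: (Rintegrable_measurable (Rintegrable_triangleM e0)).
    under eq_fun do rewrite mulrAC.
    exact: measurable_cosM.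
  move=> t; rewrite !normrM -[leRHS]mul1r -[leRHS]mulr1.
  rewrite ler_pM ?mulr_ge0 ?cos_max// ler_pM//.
  by rewrite ger0_norm ?triangle_ge0// triangle_le1.
apply: le_trans (ler_norm _) _.
apply: le_trans (le_normr_Rintegral measurableT i1) _.
apply: le_Rintegral => //; [exact: Rintegrable_norm i1|exact: Rintegrable_norm Ci|].
move=> t _; rewrite !normrM -[leRHS]mul1r -[leRHS]mulr1.
rewrite ler_pM ?mulr_ge0 ?cos_max// ler_pM//.
by rewrite ger0_norm ?triangle_ge0// triangle_le1.
Qed.

End fejer_average.

Section fejer_domination.
Context (R : realType).
Local Notation leb := (@lebesgue_measure R).
Local Notation P := (costr leb (@triangle R)).
Variable nu : probability (measurableTypeR R) R.
Hypothesis nu_sin : forall t, \int[nu]_x sin (2 * pi * t * x) = 0.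
Hypothesis Ci : Rintegrable leb (charf nu).

Lemma fejer_lb (e w : R) : 0 < e -> 2 * pi * `|w| <= e -> e^-1 * cos 1 <= fejer e w.
Proof.
move=> e0 we; rewrite fejerE// ler_wpM2l ?invr_ge0 ?(ltW e0)//.
apply: costr_triangle_lb; rewrite mulrA normrM normrV ?unitfE ?gt_eqF//.
rewrite (gtr0_norm e0) ler_pdivrMr// mul1r normrM.
by rewrite (gtr0_norm (_ : 0 < 2 * pi))// mulr_gt0// pi_gt0.
Qed.

Lemma Rintegrable_fejer e y : 0 < e -> Rintegrable nu (fun x => fejer e (x - y)).
Proof.
move=> e0; apply: (@probability_Rintegrable _ _ _ _ _ e^-1).
  apply: measurableT_comp (measurable_fejer e0) _.
  exact: measurable_funB.
by move=> x; rewrite ger0_norm ?fejer_ge0// fejer_le.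
Qed.

(** A law with an integrable characteristic function gives an interval a mass at most
    proportional to its length: the Fejer kernel whose scale is proportional to that
    length is bounded below on the interval by a multiple of the inverse of the length. *)
Lemma probability_itv_le : exists2 M, 0 < M &
  forall a b : R, a < b -> (nu `]a, b]%classic <= (M * (b - a))%:E)%E.
Proof.
set N := \int[leb]_t `|charf nu t|.
have N0 : 0 <= N by apply: Rintegral_ge0.
have p0 := pi_gt0 R; have c0 : 0 < cos 1 :> R := @cos1_gt0 R.
exists (N * pi / cos 1 + 1) => [|a b ab].
  by rewrite ltr_wpDl// divr_ge0 ?mulr_ge0// ltW.
(* [fejer_lb] asks for [2 * pi * `|x - y| <= e]; on the interval [`|x - y| <= (b - a) / 2]. *)
pose y := (a + b) / 2; pose e := pi * (b - a).
have e0 : 0 < e by rewrite mulr_gt0// subr_gt0.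
have fnu : nu `]a, b]%classic \is a fin_num by rewrite fin_num_measure.
have : \int[nu]_x (e^-1 * cos 1 * \1_(`]a, b]%classic : set R) x) <= N.
  apply: le_trans (Rintegral_fejer_le nu_sin Ci y e0).
  apply: le_Rintegral => //.
  - by apply: RintegrableZl; exact: integrable_indic.
  - exact: Rintegrable_fejer.
  - move=> x _; rewrite indicE; case: (boolP (x \in _)) => [|_]; last first.
      by rewrite mulr0 fejer_ge0.
    rewrite inE/= in_itv/= => /andP[ax xb]; rewrite mulr1; apply: fejer_lb => //.
    rewrite /e mulrAC [leRHS]mulrC ler_wpM2r ?(ltW p0)//.
    have : `|x - y| <= (b - a) / 2 by rewrite ler_norml /y; apply/andP; split; lra.
    lra.
rewrite RintegralZl//; last exact: integrable_indic.
rewrite /Rintegral integral_indic// setIT.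
rewrite -[X in (X <= _)%E]fineK// lee_fin; set v := fine _ => ev.
have v0 : 0 <= v by rewrite fine_ge0.
have : v * cos 1 <= N * e.
  rewrite [N * e]mulrC (_ : v * cos 1 = e * (e^-1 * cos 1 * v)).
    by rewrite ler_wpM2l// ltW.
  by field; rewrite gt_eqF.
rewrite /e => h.
have : v <= N * (pi * (b - a)) / cos 1 by rewrite ler_pdivlMr.
move=> h'; apply: le_trans h' _.
have -> : N * (pi * (b - a)) / cos 1 = N * pi / cos 1 * (b - a) by ring.
by rewrite ler_wpM2r ?lerDl// subr_ge0 ltW.
Qed.

(** Two applications of Fubini's theorem, then the substitution [y = e * z + x], turn the
    regularized right-hand side of the inversion formula into an average of [f] near
    each point [x]. *)
Lemma Rintegral_fejer_swap (f : R -> R) e : 0 < e -> Rintegrable leb f ->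
  measurable_fun [set: R] (fun x => \int[leb]_z (f (e * z + x) * P z)) /\
  \int[leb]_t (triangle (e * t) * (charf nu t * costr leb f t)) =
  \int[nu]_x \int[leb]_z (f (e * z + x) * P z).
Proof.
move=> e0 fi.
have mf := Rintegrable_measurable fi.
have ti := Rintegrable_triangleM e0.
have tCi : Rintegrable leb (fun t => triangle (e * t) * charf nu t).
  by apply: (RintegrableM_bounded ti (measurable_charf nu)) => t; exact: charf_le1.
have [_ _ E1] := @Rfubini _ _ _ _ R leb leb _ _ _ 1
  tCi fi (@measurable_cos_prod R) (fun z => cos_max _).
pose b (z : measurableTypeR R * measurableTypeR R) := fejer e (z.2 - z.1).
have mb : measurable_fun setT b.
  apply: measurableT_comp (measurable_fejer e0) _.
  exact: measurable_funB.
have bM z : `|b z| <= e^-1 by rewrite ger0_norm ?fejer_ge0// fejer_le.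
have [_ I2 E2] := @Rfubini _ _ _ _ R leb nu _ _ _ e^-1 fi (Rintegrable_prob1 nu) mb bM.
have inner x : \int[leb]_y (f y * 1 * b (y, x)) = \int[leb]_z (f (e * z + x) * P z).
  have mfe : measurable_fun [set: R] (fun y => fejer e (x - y)).
    apply: measurableT_comp (measurable_fejer e0) _.
    exact: measurable_funB.
  have i1 : Rintegrable leb (fun y => f y * fejer e (x - y)).
    apply: (RintegrableM_bounded (M := e^-1) fi mfe) => y.
    by rewrite ger0_norm ?fejer_ge0// fejer_le.
  transitivity (\int[leb]_y (f y * fejer e (x - y))).
    by apply: eq_Rintegral => y _; rewrite mulr1.
  rewrite (Rintegral_affine x e0 i1) -RintegralZl//; last exact: (Rintegrable_affine x e0 i1).
  apply: eq_Rintegral => z _; rewrite fejerE// /affine.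
  have -> : (x - (e * z + x)) / e = - z by field; rewrite gt_eqF.
  by rewrite costrN mulrCA mulVKf// gt_eqF.
split.
  apply: eq_measurable_fun (Rintegrable_measurable I2) => x _.
  exact: inner.
transitivity (\int[leb]_x \int[leb]_y (triangle (e * x) * charf nu x * f y * cos (2 * pi * (x, y).1 * (x, y).2))).
  apply: eq_Rintegral => t _; rewrite mulrA -RintegralZl//; last exact: Rintegrable_cosM.
  by apply: eq_Rintegral => y _; rewrite /= mulrA.
rewrite E1.
transitivity (\int[leb]_y \int[nu]_x (f y * 1 * b (y, x))).
  apply: eq_Rintegral => y _; rewrite RintegralZl//; last exact: Rintegrable_fejer.
  have it : Rintegrable leb (fun t => triangle (e * t) * charf nu t * cos (2 * pi * t * y)).
    apply: (RintegrableM_bounded (M := 1) tCi) => [|t]; last exact: cos_max.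
    under eq_fun do rewrite mulrAC.
    exact: measurable_cosM.
  rewrite mulr1 /b/= Rintegral_fejer// -RintegralZl//.
  by apply: eq_Rintegral => t _ /=; ring.
rewrite E2; apply: eq_Rintegral => x _; exact: inner.
Qed.

End fejer_domination.

(** * Inversion formula *)

Section inversion_continuous.
Context (R : realType).
Local Notation leb := (@lebesgue_measure R).
Local Notation P := (costr leb (@triangle R)).
Variable nu : probability (measurableTypeR R) R.
Hypothesis nu_sin : forall t, \int[nu]_x sin (2 * pi * t * x) = 0.
Hypothesis Ci : Rintegrable leb (charf nu).
Local Notation c := (\int[leb]_z P z).

(** Inversion formula for bounded functions continuous [nu]-almost everywhere: dominated
    convergence as the scale tends to 0 on both sides of [Rintegral_fejer_swap]. *)
Lemma inversion_ae_continuous (f : R -> R) (B : R) : Rintegrable leb f ->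
  (forall x, `|f x| <= B) -> {ae nu, forall x, {for x, continuous f}} ->
  c * \int[nu]_x f x = \int[leb]_t (charf nu t * costr leb f t).
Proof.
move=> fi fB cf; have mf := Rintegrable_measurable fi.
pose e (n : nat) : R := n.+1%:R^-1.
have e0 n : 0 < e n by rewrite invr_gt0.
have e_cvg : e n @[n --> \oo] --> (0 : R) := cvg_harmonic.
have Pi := @Rintegrable_costr_triangle R.
have P0 := @costr_triangle_ge0 R.
have B0 : 0 <= B by rewrite (le_trans _ (fB 0)).
have limr : \int[leb]_t (triangle (e n * t) * (charf nu t * costr leb f t)) @[n --> \oo]
    --> \int[leb]_t (charf nu t * costr leb f t).
  have mC : measurable_fun [set: R] (fun t => charf nu t * costr leb f t).
    by apply: measurable_funM; [exact: measurable_charf|exact: measurable_costr].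
  apply: (@Rintegral_dominated_cvg _ _ _ leb
    (fun n t => triangle (e n * t) * (charf nu t * costr leb f t)) _
    (fun t => (\int[leb]_y `|f y|) * `|charf nu t|)).
  - move=> n; apply: measurable_funM => //.
    exact: (Rintegrable_measurable (Rintegrable_triangleM (e0 n))).
  - exact: mC.
  - apply: aeW => t; rewrite -[X in _ --> X]mul1r; apply: cvgMl.
    rewrite -(triangle0 R).
    apply: (@continuous_cvg _ _ _ _ _ _ (@triangle R)).
      exact: continuous_triangle.
    by rewrite -[X in _ --> X](mul0r t); exact: cvgMl.
  - move=> n t; rewrite normrM ger0_norm ?triangle_ge0// -[leRHS]mul1r.
    rewrite ler_pM ?triangle_ge0 ?triangle_le1// normrM mulrC ler_wpM2r//.
    exact: le_costr.
  - exact: (RintegrableZl _ (Rintegrable_norm Ci)).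
have inner x : {for x, continuous f} ->
    \int[leb]_z (f (e n * z + x) * P z) @[n --> \oo] --> f x * c.
  move=> cfx; rewrite -(RintegralZl (f x) measurableT Pi).
  apply: (@Rintegral_dominated_cvg _ _ _ leb
    (fun n z => f (e n * z + x) * P z) (fun z => f x * P z) (fun z => B * P z)).
  - move=> n; apply: measurable_funM; last exact: measurable_costr_triangle.
    apply: (measurableT_comp mf).
    exact: (@measurable_affine R (e n) x).
  - by apply: measurable_funM => //; exact: measurable_costr_triangle.
  - apply: aeW => z; apply: cvgMl.
    apply: (@continuous_cvg _ _ _ _ _ _ f) => //.
    rewrite -[X in _ --> X](add0r x); apply: cvgD; last exact: cvg_cst.
    by rewrite -[X in _ --> X](mul0r z); exact: cvgMl.
  - by move=> n z; rewrite normrM (ger0_norm (P0 z)) ler_wpM2r.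
  - exact: RintegrableZl.
have liml : \int[nu]_x \int[leb]_z (f (e n * z + x) * P z) @[n --> \oo]
    --> \int[nu]_x (f x * c).
  apply: (@Rintegral_dominated_cvg _ _ _ nu
    (fun n x => \int[leb]_z (f (e n * z + x) * P z)) (fun x => f x * c) (fun=> B * c)).
  - by move=> n; have [] := Rintegral_fejer_swap nu_sin (e0 n) fi.
  - exact: measurable_funM.
  - case: cf => N [mN N0 sN]; exists N; split => // x /= h; apply: sN => /= hx.
    by apply: h; exact: inner.
  - move=> n x.
    have i1 : Rintegrable leb (fun z => f (e n * z + x) * P z).
      apply: (@le_Rintegrable _ (measurableTypeR R) R leb _ (fun z => B * P z)).
      + apply: measurable_funM; last exact: measurable_costr_triangle.
        apply: (measurableT_comp mf).
        exact: (@measurable_affine R (e n) x).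
      + by move=> z; rewrite normrM (ger0_norm (P0 z)) ler_wpM2r.
      + exact: RintegrableZl.
    apply: le_trans (le_normr_Rintegral measurableT i1) _.
    rewrite -RintegralZl//; apply: le_Rintegral => //.
    + exact: Rintegrable_norm i1.
    + exact: RintegrableZl.
    + by move=> z _; rewrite normrM (ger0_norm (P0 z)) ler_wpM2r.
  - exact: finite_measure_integrable_cst.
have fnu : Rintegrable nu f by exact: (probability_Rintegrable nu mf fB).
rewrite mulrC -RintegralZr//.
apply: (cvg_unique (@Rhausdorff R) liml).
apply: cvg_trans limr; apply: near_eq_cvg; apply: nearW => n.
by have [_ <-] := Rintegral_fejer_swap nu_sin (e0 n) fi.
Qed.

End inversion_continuous.

Section density_L1.
Context (R : realType).
Local Notation leb := (@lebesgue_measure R).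

Lemma eq0_of_cvg_bound (x : R) (a : nat -> R) :
  (forall n, `|x| <= a n) -> a n @[n --> \oo] --> 0 -> x = 0.
Proof.
move=> xa a0; apply/normr0_eq0/eqP; rewrite eq_le normr_ge0 andbT.
apply: (ler_cvg_to (cvg_cst `|x|) a0).
exact: nearW.
Qed.

(** A functional which is Lipschitz for the L^1 distance and vanishes on truncated
    continuous functions vanishes on L^1. Linearity of [Q] is not needed. *)
Lemma L1_density0 (Q : (R -> R) -> R) (K : R) :
  (forall u v, Rintegrable leb u -> Rintegrable leb v ->
    `|Q u - Q v| <= K * \int[leb]_x `|u x - v x|) ->
  (forall (g : R -> R) (N : nat), continuous g -> Q (g \_ `[- N%:R, N%:R]) = 0) ->
  forall u, Rintegrable leb u -> Q u = 0.
Proof.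
move=> QK Qg u ui.
pose I N : set (measurableTypeR R) := `[- N%:R, N%:R]%classic.
have mI N : measurable (I N) by exact: measurable_itv.
have restr (f : R -> R) N : leb.-integrable (I N) (EFin \o f) -> Rintegrable leb (f \_ (I N)).
  by move=> fi; rewrite -restrict_EFin; apply/(integrable_mkcond _ (mI N)).
have uI N : leb.-integrable (I N) (EFin \o u) by exact: integrableS ui.
have step N : Q (u \_ (I N)) = 0.
  have I_fin : (leb (I N) < +oo)%E.
    by rewrite lebesgue_measure_itv/=; case: ifP => _; exact: ltry.
  have [g [cg gi gcvg]] := approximation_continuous_integrable (mI N) I_fin (uI N).
  apply: (@eq0_of_cvg_bound _ (fun n => K * fine (\int[leb]_(z in I N) `|(u z - g n z)%:E|)%E)).
  - move=> n; rewrite -[Q _]subr0 -(Qg (g n) N (cg n)).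
    apply: le_trans (QK _ _ (restr _ _ (uI N)) (restr _ _ (gi n))) _.
    rewrite le_eqVlt; apply/orP; left; apply/eqP; congr (_ * _).
    rewrite /Rintegral [in RHS]integral_mkcond; congr fine.
    apply: eq_integral => x _; rewrite !patchE; case: ifP => _ //.
    by rewrite subrr normr0.
  - by rewrite -[X in _ --> X](mulr0 K); apply: cvgMr; exact: fine_cvg gcvg.
apply: (@eq0_of_cvg_bound _ (fun N => K * \int[leb]_x `|u x - (u \_ (I N)) x|)).
  move=> N; rewrite -[Q u]subr0 -(step N).
  exact: QK (restr _ _ (uI N)).
rewrite -[X in _ --> X](mulr0 K); apply: cvgMr.
rewrite (_ : 0 = \int[leb]_x (0 : R)); last by rewrite /Rintegral integral0.
have mu := Rintegrable_measurable ui.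
apply: (@Rintegral_dominated_cvg _ _ _ leb (fun N x => `|u x - (u \_ (I N)) x|) _ (fun x => `|u x|)).
- move=> N; apply: measurableT_comp => //; apply: measurable_funB => //.
  exact: (Rintegrable_measurable (restr _ _ (uI N))).
- exact: measurable_cst.
- apply: aeW => x; apply: cvg_near_cst.
  near=> N; rewrite patchE ifT ?subrr ?normr0//.
  rewrite inE /I/= in_itv/= -ler_norml.
  by near: N; exact: nbhs_infty_ger.
- move=> N x; rewrite patchE; case: ifP => _; last by rewrite subr0 normr_id.
  by rewrite subrr !normr0.
- exact: Rintegrable_norm ui.
Unshelve. all: by end_near. Qed.

End density_L1.

Section inversion_L1.
Context (R : realType).
Local Notation leb := (@lebesgue_measure R).
Local Notation P := (costr leb (@triangle R)).
Variable nu : probability (measurableTypeR R) R.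
Hypothesis nu_sin : forall t, \int[nu]_x sin (2 * pi * t * x) = 0.
Hypothesis Ci : Rintegrable leb (charf nu).
Local Notation c := (\int[leb]_z P z).

Lemma costrB (u v : R -> R) t : Rintegrable leb u -> Rintegrable leb v ->
  costr leb u t - costr leb v t = costr leb (fun x => u x - v x) t.
Proof.
move=> ui vi; rewrite /costr -RintegralB//; [|exact: Rintegrable_cosM..].
by apply: eq_Rintegral => x _; rewrite mulrBl.
Qed.

Lemma Rintegrable_charfM (u : R -> R) : Rintegrable leb u ->
  Rintegrable leb (fun t => charf nu t * costr leb u t).
Proof.
move=> ui; apply: (RintegrableM_bounded Ci (measurable_costr ui)) => t.
exact: le_costr.
Qed.

(** The truncation of a continuous function is discontinuous at two points at most,
    which are negligible since [nu] is dominated by the Lebesgue measure. *)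
Lemma inversion_L1 (u : R -> R) : Rintegrable leb u ->
  c * \int[nu]_x u x = \int[leb]_t (charf nu t * costr leb u t).
Proof.
have [M M0 nuM] := probability_itv_le nu_sin Ci.
have c0 := Rintegral_costr_triangle_gt0 R.
set C1 := \int[leb]_t `|charf nu t|.
move=> ui; apply/eqP; rewrite -subr_eq0; apply/eqP; move: u ui.
apply: (@L1_density0 _ _ (c * M + C1)) => [u v ui vi|g N cg].
- have uvi := RintegrableB ui vi.
  have uni := lebesgue_Rintegrable_comparison M0 nuM ui.
  have vni := lebesgue_Rintegrable_comparison M0 nuM vi.
  have uvni := lebesgue_Rintegrable_comparison M0 nuM uvi.
  have un := Rintegrable_charfM ui; have vn := Rintegrable_charfM vi.
  rewrite opprD opprK addrACA -mulrBr -RintegralB// mulrDl.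
  rewrite [X in `|_ + X|]addrC -RintegralB//.
  apply: le_trans (ler_normD _ _) _; apply: lerD.
    rewrite normrM (gtr0_norm c0) -mulrA ler_pM2l//.
    apply: le_trans (le_normr_Rintegral measurableT uvni) _.
    apply: (le_Rintegral_lebesgue M0 nuM) => //.
    exact: Rintegrable_norm uvi.
  apply: le_trans (le_normr_Rintegral measurableT (RintegrableB vn un)) _.
  rewrite mulrC -RintegralZl//; last exact: Rintegrable_norm Ci.
  apply: le_Rintegral => //.
  + exact: Rintegrable_norm (RintegrableB vn un).
  + exact: (RintegrableZl _ (Rintegrable_norm Ci)).
  + move=> t _; rewrite -mulrBr normrM mulrC ler_wpM2r//.
    by rewrite distrC costrB//; exact: le_costr.
- set f := g \_ _; apply/eqP; rewrite subr_eq0; apply/eqP.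
  have cpt : compact (`[- N%:R, N%:R]%classic : set R) by exact: segment_compact.
  have ctsg : {within (`[- N%:R, N%:R]%classic : set R), continuous g}.
    exact: continuous_subspaceT.
  have /compact_bounded[B [Br gB]] := continuous_compact ctsg cpt.
  have fi : Rintegrable leb f.
    have mI : measurable (`[- N%:R, N%:R]%classic : set (measurableTypeR R)).
      exact: measurable_itv.
    rewrite -restrict_EFin; apply/(integrable_mkcond _ mI).
    exact: continuous_compact_integrable.
  apply: (inversion_ae_continuous (B := `|B| + 1) nu_sin Ci fi).
    move=> x; rewrite /f patchE; case: ifP => xN; last first.
      by rewrite normr0 addr_ge0.
    apply: (gB (`|B| + 1)); last by exists x => //; rewrite inE in xN.
    by rewrite (le_lt_trans (ler_norm _))// ltrDl.
  exists [set N%:R; - N%:R]; split.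
  + by apply: measurableU; exact: measurable_set1.
  + have : leb [set N%:R; - N%:R] = 0%E.
      apply: countable_lebesgue_measure0; exact: finite_set_countable (finite_set2 _ _).
    have /null_content_dominatesP dom := null_dominates_lebesgue M0 nuM.
    by apply: dom; apply: measurableU; exact: measurable_set1.
  + move=> x /=; apply: contra_notP => /not_orP[xN xN'].
    have [xin|xout] := lerP `|x| N%:R.
      have {}xin : `|x| < N%:R.
        rewrite lt_neqAle xin andbT; apply/negP => /eqP.
        case: (ger0P x) => _ e; first by apply: xN.
        by apply: xN'; rewrite -e opprK.
      have fg y : `|y| < N%:R -> f y = g y.
        by move=> yN; rewrite /f patchE ifT// inE/= in_itv/= -ler_norml ltW.
      have nx : \forall y \near x, `|y| < N%:R.
        exact: (cvgr_lt _ (@norm_continuous _ _ x) _ xin).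
      have gf : {near x, g =1 f}.
        by apply: filterS nx => y yN; rewrite fg.
      rewrite /prop_for /continuous_at (fg x xin).
      apply: cvg_trans (cg x).
      by apply: near_eq_cvg; apply: filterS gf => y ->.
    apply: (@near_cst_continuous _ _ (0 : R)).
    have nx : \forall y \near x, N%:R < `|y|.
      exact: (cvgr_gt _ (@norm_continuous _ _ x) _ xout).
    apply: filterS nx => y /= yN; rewrite /f patchE ifF//; apply/negbTE.
    by rewrite notin_setE/= in_itv/= -ler_norml; apply/negP; rewrite -ltNge.
Qed.

End inversion_L1.

Section L2_tools.
Context d (T : measurableType d) (R : realType) (m : {measure set T -> \bar R}).
Local Open Scope ereal_scope.

(** Monotonicity needs no measurability, as the integral of a nonnegative function is a
    supremum over the simple functions below it. *)
Lemma ge0_le_integral_nonmeas (f g : T -> \bar R) : (forall x, 0 <= f x) ->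
  (forall x, f x <= g x) -> \int[m]_x f x <= \int[m]_x g x.
Proof.
move=> f0 fg; rewrite !ge0_integralTE//; last by move=> x; exact: le_trans (f0 x) (fg x).
apply: ge_ereal_sup => _ [h hf <-]; apply: ereal_sup_ubound; exists h => // x.
exact: le_trans (hf x) (fg x).
Qed.

Lemma integral_poweR_ge0 (f : T -> \bar R) r : 0 <= \int[m]_x (`|f x| `^ r).
Proof. by apply: integral_ge0 => x _; exact: poweR_ge0. Qed.

Lemma le_Lnorm2 (f g : T -> R) : (forall x, (`|f x| <= `|g x|)%R) ->
  'N[m]_2%:E[EFin \o f] <= 'N[m]_2%:E[EFin \o g].
Proof.
move=> fg; rewrite unlock gt0_ler_poweR ?invr_ge0//.
- by rewrite in_itv/= leey andbT integral_ge0// => x _; rewrite lee_fin powR_ge0.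
- by rewrite in_itv/= leey andbT integral_ge0// => x _; rewrite lee_fin powR_ge0.
apply: ge0_le_integral_nonmeas => x; first exact: poweR_ge0.
by rewrite /= lee_fin ge0_ler_powR.
Qed.

Lemma cauchy_schwarz (f g : T -> R) : measurable_fun setT f -> measurable_fun setT g ->
  \int[m]_x `|(f x * g x)%:E| <= 'N[m]_2%:E[EFin \o f] * 'N[m]_2%:E[EFin \o g].
Proof.
move=> mf mg.
have two : (2^-1 + 2^-1 = 1 :> R)%R by rewrite [RHS]splitr !div1r.
by have := @hoelder _ _ _ m f g 2 2 mf mg (ltr0Sn _ _) (ltr0Sn _ _) two; rewrite Lnorm1.
Qed.

Lemma cvg_of_ereal_bound (x_ : nat -> R) (x : R) (b : nat -> \bar R) (K : R) :
  (forall k, `|x_ k - x|%:E <= K%:E * b k) -> b k @[k --> \oo] --> 0 ->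
  x_ k @[k --> \oo] --> x.
Proof.
move=> xb b0.
have : `|x_ k - x|%:E @[k --> \oo] --> 0%:E.
  apply: (@squeeze_cvge _ _ _ _ (cst 0) _ (fun k => K%:E * b k)).
  - by apply: nearW => k; rewrite /= lee_fin normr_ge0 xb.
  - exact: cvg_cst.
  - by have := @cvgeZl _ _ _ _ _ K%:E isT b0; rewrite mule0.
move/fine_cvg => /= xcvg.
by apply/subr_cvg0/norm_cvg0P.
Qed.

End L2_tools.

Section inversion_L2.
Context (R : realType).
Local Notation leb := (@lebesgue_measure R).
Local Notation P := (costr leb (@triangle R)).
Variable nu : probability (measurableTypeR R) R.
Hypothesis nu_sin : forall t, \int[nu]_x sin (2 * pi * t * x) = 0.
Hypothesis Ci : Rintegrable leb (charf nu).
Local Notation c := (\int[leb]_z P z).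

Lemma charf_L2 : charf nu \in Lfun leb 2%:E.
Proof.
have mC := measurable_charf nu.
rewrite inE; apply/andP; split; rewrite inE//= /finite_norm unlock.
apply: poweR_lty; case/integrableP : Ci => _; apply: le_lt_trans.
apply: ge0_le_integral_nonmeas => x; first exact: poweR_ge0.
rewrite /= lee_fin powR_mulrn// expr2 -[leRHS]mul1r.
by rewrite ler_wpM2r//; exact: charf_le1.
Qed.

(** Cauchy-Schwarz against the constant 1, then comparison of [nu] with the Lebesgue
    measure. *)
Lemma Lfun2_comparison (u : R -> R) (M : R) : 0 < M ->
  (forall a b : R, a < b -> (nu `]a, b]%classic <= (M * (b - a))%:E)%E) ->
  measurable_fun [set: R] u ->
  (\int[nu]_x `|(u x)%:E| <= (M `^ 2^-1)%:E * 'N[leb]_2%:E[EFin \o u])%E.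
Proof.
move=> M0 nuM mu.
have two : 2^-1 + 2^-1 = 1 :> R by rewrite [RHS]splitr !div1r.
have m1 : measurable_fun [set: R] (fun=> 1 : R) by exact: measurable_cst.
have := @hoelder _ _ _ nu u (fun=> 1) 2 2 mu m1 (ltr0Sn _ _) (ltr0Sn _ _) two.
rewrite Lnorm1 /=; under eq_integral do rewrite mulr1.
move=> /le_trans; apply.
have -> : ('N[nu]_2%:E[EFin \o (fun=> 1%R)] = 1)%E.
  rewrite (Lnorm_cst1 nu 2) [X in (X `^ _)%E](probability_setT nu); by rewrite ?poweR1e ?poweR1r ?powR1.
rewrite mule1 unlock -poweR_EFin -poweRM ?lee_fin ?(ltW M0)//; last first.
  by exact: integral_poweR_ge0.
rewrite gt0_ler_poweR ?invr_ge0//.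
- by rewrite in_itv/= leey andbT integral_ge0// => x _; rewrite lee_fin powR_ge0.
- rewrite in_itv/= leey andbT mule_ge0 ?lee_fin ?(ltW M0)//.
  by rewrite integral_ge0// => x _; rewrite lee_fin powR_ge0.
apply: (ge0_integral_le_lebesgue M0 nuM) => [|x]; last exact: poweR_ge0.
apply: measurableT_comp (measurable_poweR 2) _.
by apply: measurableT_comp => //; exact/measurable_EFinP.
Qed.

(** Both sides of [inversion_L1] pass to the limit along the approximating sequence that
    defines the Fourier transform on L^2. *)
Lemma inversion_L2 (h : R -> R) (hhat : R -> R[i]) :
  h \in Lfun leb 2%:E -> is_fourierL2 h hhat ->
  [/\ Rintegrable nu h, Rintegrable leb (fun t => charf nu t * complex.Re (hhat t)) &
  c * \int[nu]_x h x = \int[leb]_t (charf nu t * complex.Re (hhat t))].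
Proof.
move=> h2 [[rh2 _] [u [u12 uh uhat]]].
have [M M0 nuM] := probability_itv_le nu_sin Ci.
have c0 := Rintegral_costr_triangle_gt0 R.
have mh : measurable_fun [set: R] h by move: h2; rewrite inE => /andP[]; rewrite inE.
have mrh : measurable_fun [set: R] (fun t => complex.Re (hhat t)).
  by move: rh2; rewrite inE => /andP[]; rewrite inE.
have ui k : Rintegrable leb (u k) by apply/Lfun1_integrable; case: (u12 k).
have muk k := Rintegrable_measurable (ui k).
have hfin : ('N[leb]_2%:E[EFin \o h] < +oo)%E.
  by move: h2; rewrite inE => /andP[_]; rewrite inE.
have hi : Rintegrable nu h.
  apply/integrableP; split; first exact/measurable_EFinP.
  apply: le_lt_trans (Lfun2_comparison M0 nuM mh) _.
  by rewrite lte_mul_pinfty// lee_fin powR_ge0.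
have rhi : Rintegrable leb (fun t => charf nu t * complex.Re (hhat t)).
  by apply/Lfun1_integrable; exact: Lfun2_mul_Lfun1 charf_L2 rh2.
split => //.
have uni k := lebesgue_Rintegrable_comparison M0 nuM (ui k).
have lim1 : c * \int[nu]_x u k x @[k --> \oo] --> c * \int[nu]_x h x.
  apply: cvgMr; apply: (@cvg_of_ereal_bound _ _ _ _ (M `^ 2^-1) _ uh) => k.
  rewrite -RintegralB// EFin_normr_Rintegral//; last exact: RintegrableB.
  apply: le_trans (le_abse_integral _ measurableT _) _.
    exact: measurable_int (RintegrableB (uni k) hi).
  apply: (Lfun2_comparison M0 nuM).
  exact: (measurable_funB (muk k) mh).
have lim2 : \int[leb]_t (charf nu t * costr leb (u k) t) @[k --> \oo] -->
    \int[leb]_t (charf nu t * complex.Re (hhat t)).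
  pose K := fine 'N[leb]_2%:E[EFin \o charf nu]%E.
  have KE : 'N[leb]_2%:E[EFin \o charf nu]%E = K%:E.
    rewrite fineK// ge0_fin_numE ?Lnorm_ge0//.
    by have := charf_L2; rewrite inE => /andP[_]; rewrite inE.
  apply: (@cvg_of_ereal_bound _ _ _ _ K _ uhat) => k.
  have cui := Rintegrable_charfM Ci (ui k).
  rewrite -RintegralB// EFin_normr_Rintegral//; last exact: RintegrableB.
  apply: le_trans (le_abse_integral _ measurableT _) _.
    exact: measurable_int (RintegrableB cui rhi).
  have mcu := measurable_costr (ui k).
  under eq_integral do rewrite -mulrBr.
  have md : measurable_fun [set: R] (fun t => costr leb (u k) t - complex.Re (hhat t)).
    exact: measurable_funB.
  apply: le_trans (cauchy_schwarz leb (measurable_charf nu) md) _.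
  rewrite KE lee_wpmul2l//; first by rewrite -KE Lnorm_ge0.
  apply: le_Lnorm2 => t.
  rewrite /fourier; case: (hhat t) => a b /=.
  rewrite [leRHS]ger0_norm ?sqrtr_ge0// -sqrtr_sqr ler_wsqrtr//.
  by rewrite lerDl sqr_ge0.
apply: (cvg_unique (@Rhausdorff R) lim1).
apply: cvg_trans lim2; apply: near_eq_cvg; apply: nearW => k.
by rewrite (inversion_L1 nu_sin Ci (ui k)).
Qed.

End inversion_L2.

(** * Linear combinations of independent variables *)

Section lincomb.
Context (R : realType).

(** The linear form with coefficients [al] on tuples. *)
Definition lincomb n (al : 'I_n -> R) (x : n.-tuple (measurableTypeR R)) : measurableTypeR R :=
  \sum_(i < n) al i * tnth x i.

Lemma measurable_lincomb n (al : 'I_n -> R) : measurable_fun setT (lincomb al).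
Proof.
apply: measurable_sum => i; apply: measurable_funM => //.
exact: measurable_tnth.
Qed.

HB.instance Definition _ n (al : 'I_n -> R) :=
  @isMeasurableFun.Build _ _ _ _ (lincomb al) (measurable_lincomb al).

Lemma lincomb_cons n (al : 'I_n.+1 -> R) (z : measurableTypeR R * n.-tuple (measurableTypeR R)) :
  lincomb al (tuple_cons z) = al ord0 * z.1 + lincomb (fun i => al (lift ord0 i)) z.2.
Proof.
rewrite /lincomb big_ord_recl; congr (_ + _).
by apply: eq_bigr => i _; rewrite tnthS.
Qed.

Lemma Rintegral_distribution d d' (T : measurableType d) (T' : measurableType d')
    (P : probability T R) (X : {mfun T >-> T'}) (f : T' -> R) :
  measurable_fun setT f -> Rintegrable P (f \o X) ->
  \int[distribution P X]_y f y = \int[P]_x f (X x).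
Proof.
move=> mf fi; rewrite /Rintegral integral_distribution//.
exact/measurable_EFinP.
Qed.

Variable mu : probability (measurableTypeR R) R.
Hypothesis mu_sin : forall t, \int[mu]_x sin (2 * pi * t * x) = 0.

(** The characteristic function of a linear combination of independent variables is the
    product of the rescaled characteristic functions; the sine part must be carried
    along in the induction. *)
Lemma charf_lincomb n (al : 'I_n -> R) t :
  \int[power_probability mu n]_x cos (2 * pi * t * lincomb al x) =
    \prod_(i < n) charf mu (al i * t) /\
  \int[power_probability mu n]_x sin (2 * pi * t * lincomb al x) = 0.
Proof.
elim: n al => [|n IH] al.
  rewrite big_ord0 /Rintegral /= !integral_dirac//=.
  - by rewrite !indicE in_setT !mul1r /lincomb big_ord0 mulr0 cos0 sin0.
  - apply/measurable_EFinP; apply: measurableT_comp (measurable_sinM _) _.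
    exact: measurable_lincomb.
  - apply/measurable_EFinP; apply: measurableT_comp (measurable_cosM _) _.
    exact: measurable_lincomb.
have [IHc IHs] := IH (fun i => al (lift ord0 i)).
set be := fun i => al (lift ord0 i) in IHc IHs *.
have mc : measurable_fun setT (fun x => cos (2 * pi * t * lincomb be x)).
  by apply: measurableT_comp (measurable_cosM _) _; exact: measurable_lincomb.
have ms : measurable_fun setT (fun x => sin (2 * pi * t * lincomb be x)).
  by apply: measurableT_comp (measurable_sinM _) _; exact: measurable_lincomb.
have ci := probability_Rintegrable (power_probability mu n) mc (fun x => cos_max _).
have si := probability_Rintegrable (power_probability mu n) ms (fun x => sin_max _).
have mc1 := @measurable_cosM R (2 * pi * (al ord0 * t)).
have ms1 := @measurable_sinM R (2 * pi * (al ord0 * t)).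
have ci1 := probability_Rintegrable mu mc1 (fun x => cos_max _).
have si1 := probability_Rintegrable mu ms1 (fun x => sin_max _).
have arg (z : measurableTypeR R * n.-tuple (measurableTypeR R)) :
    2 * pi * t * lincomb al (tuple_cons z) =
    2 * pi * (al ord0 * t) * z.1 + 2 * pi * t * lincomb be z.2.
  by rewrite lincomb_cons; ring.
have key (g : R -> R) : measurable_fun [set: R] g -> (forall x, `|g x| <= 1) ->
    \int[power_probability mu n.+1]_x g (2 * pi * t * lincomb al x) =
    \int[mu]_x \int[power_probability mu n]_y
      g (2 * pi * (al ord0 * t) * x + 2 * pi * t * lincomb be y).
  move=> mg g1.
  have mgl : measurable_fun setT (fun x => g (2 * pi * t * lincomb al x)).
    apply: measurableT_comp mg _.
    by apply: measurable_funM => //; exact: measurable_lincomb.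
  have mgc : measurable_fun setT (fun z => g (2 * pi * t * lincomb al (@tuple_cons _ (measurableTypeR R) n z))).
    apply: (measurableT_comp mgl).
    exact: measurable_tuple_cons.
  rewrite /= Rintegral_distribution//; last exact: (probability_Rintegrable _ mgc (fun z => g1 _)).
  have gi : Rintegrable (mu \x power_probability mu n)%E
    (fun z => g (2 * pi * t * lincomb al (tuple_cons z))).
    exact: (probability_Rintegrable _ mgc (fun z => g1 _)).
  have [_ E] := Rfubini_integrable gi.
  rewrite /Rintegral -E; congr fine; apply: eq_integral => x _; congr EFin.
  by apply: eq_Rintegral => y _; rewrite arg.
split.
  rewrite (key _ (@measurable_cos R) (@cos_max R)).
  rewrite big_ord_recl -IHc.
  transitivity (\int[mu]_x ((\int[power_probability mu n]_y cos (2 * pi * t * lincomb be y)) *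
       cos (2 * pi * (al ord0 * t) * x))).
    apply: eq_Rintegral => x _.
    under eq_Rintegral do rewrite cosD.
    rewrite RintegralB//; [|exact: RintegrableZl..].
    by rewrite !RintegralZl// IHs mulr0 subr0 mulrC.
  by rewrite RintegralZl// mulrC.
rewrite (key _ (@measurable_sin R) (@sin_max R)).
transitivity (\int[mu]_x ((\int[power_probability mu n]_y cos (2 * pi * t * lincomb be y)) *
       sin (2 * pi * (al ord0 * t) * x))).
  apply: eq_Rintegral => x _.
  under eq_Rintegral do rewrite sinD.
  rewrite RintegralD//; [|exact: RintegrableZl..].
  by rewrite !RintegralZl// IHs mulr0 addr0 mulrC.
by rewrite RintegralZl// mu_sin mulr0.
Qed.

End lincomb.

(** * Parseval formula for laws with an integrable characteristic function *)

Section integral_formula.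
Context (R : realType).
Local Notation leb := (@lebesgue_measure R).
Local Notation P := (costr leb (@triangle R)).
Local Notation c := (\int[leb]_z P z).
Variable hhat : R -> R[i].
Hypothesis hhat_ge0 : {ae leb, forall x, 0 <= hhat x}.
Hypothesis hhat_L2 : complex_Lfun 2%:E hhat.

(** The positive part of the real part of [hhat]: almost everywhere equal to [hhat], and
    nonnegative everywhere. *)
Definition Re_pos (t : R) : R := Num.max 0 (complex.Re (hhat t)).

Lemma Re_pos_ge0 t : 0 <= Re_pos t.
Proof. by rewrite le_max lexx. Qed.

Lemma measurable_Re_hhat : measurable_fun [set: R] (fun t => complex.Re (hhat t)).
Proof. by case: hhat_L2 => + _; rewrite inE => /andP[]; rewrite inE. Qed.

Lemma measurable_Re_pos : measurable_fun [set: R] Re_pos.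
Proof.
apply: measurable_funTS; apply: measurable_maxr => //.
exact: measurable_Re_hhat.
Qed.

Lemma Re_pos_ae : {ae leb, forall t, Re_pos t = complex.Re (hhat t)}.
Proof.
case: hhat_ge0 => N [mN N0 sN]; exists N; split => // t nt; apply: sN => /=.
rewrite lecE /= => /andP[_ h0]; apply: nt.
by rewrite /= /Re_pos max_r.
Qed.

Lemma Re_pos_mul (f : R -> R) :
  Rintegrable leb (fun t => f t * complex.Re (hhat t)) -> measurable_fun [set: R] f ->
  Rintegrable leb (fun t => f t * Re_pos t) /\
  \int[leb]_t (f t * Re_pos t) = \int[leb]_t (f t * complex.Re (hhat t)).
Proof.
move=> fi mf.
have m1 : measurable_fun [set: R] (EFin \o (fun t => f t * Re_pos t)).
  by apply/measurable_EFinP; apply: measurable_funM => //; exact: measurable_Re_pos.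
have m2 := measurable_int _ fi.
have ae12 : ae_eq leb setT (EFin \o (fun t => f t * Re_pos t))
    (EFin \o (fun t => f t * complex.Re (hhat t))).
  case: Re_pos_ae => N [mN N0 sN]; exists N; split => // t nt; apply: sN => e.
  by apply: nt => _ /=; rewrite e.
split; last by rewrite /Rintegral; congr fine; exact: ae_eq_integral.
apply/integrableP; split => //.
case/integrableP : fi => _; apply: le_lt_trans.
rewrite le_eqVlt; apply/orP; left; apply/eqP.
apply: ge0_ae_eq_integral => //; [exact: measurableT_comp..|].
by apply: filterS ae12 => t /(_ I) e _; congr abse.
Qed.

Variable h : R -> R.
Hypothesis h_L2 : h \in Lfun leb 2%:E.
Hypothesis h_hhat : is_fourierL2 h hhat.

Lemma inversion_pos (nu : probability (measurableTypeR R) R) :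
  (forall t, \int[nu]_x sin (2 * pi * t * x) = 0) -> Rintegrable leb (charf nu) ->
  [/\ Rintegrable nu h, Rintegrable leb (fun t => charf nu t * Re_pos t) &
  c * \int[nu]_x h x = \int[leb]_t (charf nu t * Re_pos t)].
Proof.
move=> nus Ci; have [hi i1 e1] := inversion_L2 nus Ci h_L2 h_hhat.
have [i2 e2] := Re_pos_mul i1 (measurable_charf nu).
by split => //; rewrite e2.
Qed.

Variable mu : probability (measurableTypeR R) R.
Hypothesis mu_sin : forall t, \int[mu]_x sin (2 * pi * t * x) = 0.
Hypothesis mu_int : Rintegrable leb (charf mu).

(** All the factors are bounded by 1, so integrability of one of them suffices. *)
Lemma Rintegrable_prod_charf n (al : 'I_n -> R) (i : 'I_n) : 0 < al i ->
  Rintegrable leb (fun t => \prod_(j < n) charf mu (al j * t)).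
Proof.
move=> ai.
have mch (b : R) : measurable_fun [set: R] (fun t => charf mu (b * t)).
  by apply: measurableT_comp (measurable_charf mu) _; exact: measurable_funM.
have := Rintegrable_norm (Rintegrable_affine 0 ai mu_int).
rewrite affine0 /= => ii.
apply: (le_Rintegrable _ _ ii).
  by apply: measurable_prod => j _; exact: mch.
move=> t; rewrite (bigD1 i)//= normrM ler_piMr//.
rewrite normr_prod; apply: prodr_ile1 => j _.
by rewrite normr_ge0 charf_le1.
Qed.

Lemma integral_lincomb n (al : 'I_n -> R) (i : 'I_n) : 0 < al i ->
  Rintegrable leb (fun t => \prod_(j < n) charf mu (al j * t) * Re_pos t) /\
  c * \int[power_probability mu n]_x h (lincomb al x) =
    \int[leb]_t (\prod_(j < n) charf mu (al j * t) * Re_pos t).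
Proof.
move=> ai.
pose nu := distribution (power_probability mu n) (lincomb al).
have nu_cos t : charf nu t = \prod_(j < n) charf mu (al j * t).
  rewrite -(charf_lincomb mu_sin al t).1 /charf Rintegral_distribution//.
    exact: measurable_cosM.
  apply: (@probability_Rintegrable _ _ _ _ _ 1) => [|x]; last exact: cos_max.
  by apply: measurableT_comp (measurable_cosM _) _; exact: measurable_lincomb.
have nu_sin t : \int[nu]_x sin (2 * pi * t * x) = 0.
  rewrite -(charf_lincomb mu_sin al t).2 Rintegral_distribution//.
    exact: measurable_sinM.
  apply: (@probability_Rintegrable _ _ _ _ _ 1) => [|x]; last exact: sin_max.
  by apply: measurableT_comp (measurable_sinM _) _; exact: measurable_lincomb.
have Ci : Rintegrable leb (charf nu).
  by rewrite (funext nu_cos); exact: Rintegrable_prod_charf ai.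
have [hi i1 e1] := inversion_pos nu_sin Ci.
have mh := Rintegrable_measurable hi.
have nuE : charf nu = fun t => \prod_(j < n) charf mu (al j * t) := funext nu_cos.
rewrite nuE in i1 e1; split => //.
rewrite -e1; congr (_ * _).
rewrite [RHS]Rintegral_distribution//.
have ml := @measurable_lincomb R n al.
case/integrableP : hi => mh' hfin; apply/integrableP; split.
  exact: measurableT_comp mh' ml.
move: hfin; rewrite ge0_integral_distribution//; exact: measurableT_comp.
Qed.

End integral_formula.

(** * Hoelder inequality for geometric means *)

Section hoelder_geometric.
Context d (T : measurableType d) (R : realType) (m : {measure set T -> \bar R}).

Lemma Lnorm_powR (F : T -> R) (l : R) : 0 < l -> (forall x, 0 <= F x) ->
  ('N[m]_(l^-1)%:E[EFin \o (fun x => F x `^ l)%R] = (\int[m]_x (F x)%:E) `^ l)%E.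
Proof.
move=> l0 F0; rewrite unlock invrK; congr (_ `^ _)%E.
apply: eq_integral => x _ /=.
by rewrite ger0_norm ?powR_ge0// -powRrM divff ?gt_eqF// powRr1.
Qed.

Lemma Rintegral_geometric_le (E F G : T -> R) (l : R) : 0 < l < 1 ->
  (forall x, 0 <= E x) -> (forall x, 0 <= F x) -> (forall x, 0 <= G x) ->
  Rintegrable m E -> Rintegrable m F -> Rintegrable m G ->
  (forall x, E x <= F x `^ l * G x `^ (1 - l)) ->
  \int[m]_x E x <= (\int[m]_x F x) `^ l * (\int[m]_x G x) `^ (1 - l).
Proof.
move=> /andP[l0 l1] E0 F0 G0 Ei Fi Gi EFG.
have k0 : 0 < 1 - l by rewrite subr_gt0.
have mF := Rintegrable_measurable Fi; have mG := Rintegrable_measurable Gi.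
have mFl : measurable_fun setT (fun x => F x `^ l).
  exact: measurableT_comp (measurable_powR l) mF.
have mGl : measurable_fun setT (fun x => G x `^ (1 - l)).
  exact: measurableT_comp (measurable_powR (1 - l)) mG.
have pq : l^-1^-1 + (1 - l)^-1^-1 = 1 by rewrite !invrK subrKC.
have l0' : 0 < l^-1 by rewrite invr_gt0.
have k0' : 0 < (1 - l)^-1 by rewrite invr_gt0.
have := hoelder m mFl mGl l0' k0' pq.
rewrite Lnorm1 !Lnorm_powR// => H.
have fin f : Rintegrable m f -> ((\int[m]_x f x)%:E = \int[m]_x (f x)%:E)%E.
  by move=> fi; rewrite fineK//; exact: (integrable_fin_num measurableT fi).
rewrite -lee_fin EFinM -!poweR_EFin !fin//; apply: le_trans H.
apply: ge0_le_integral => //.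
- by move=> x _; rewrite lee_fin.
- exact: (measurable_int _ Ei).
- apply: measurableT_comp => //; apply/measurable_EFinP.
  exact: measurable_funM.
- move=> x _ /=; rewrite lee_fin ger0_norm ?EFG//.
  by rewrite mulr_ge0 ?powR_ge0.
Qed.

End hoelder_geometric.

(** * Karamata inequality *)

Section karamata.
Context (R : realType).

Variables (I : R -> Prop) (f : R -> R).
Hypothesis f_concave : forall u v w, I u -> I w -> u < v -> v < w ->
  (f w - f v) * (v - u) <= (f v - f u) * (w - v).

(** The slope of the chord of [f] between [x] and [y]; it is 0 when [x = y], a case
    excluded by the hypotheses of the monotonicity lemmas. *)
Definition slope (x y : R) := (f y - f x) / (y - x).

Lemma slopeC x y : slope x y = slope y x.
Proof. by rewrite /slope -opprB -(opprB x y) invrN mulrNN. Qed.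

Lemma slope_mono_l a b z : I a -> I b -> I z -> a < b -> a < z -> b < z ->
  slope b z <= slope a z.
Proof.
move=> Ia Ib Iz ab az bz; rewrite /slope.
rewrite ler_pdivrMr ?subr_gt0// mulrAC ler_pdivlMr ?subr_gt0//.
have := f_concave Ia Iz ab bz; lra.
Qed.

Lemma slope_mono_r a z w : I a -> I z -> I w -> a < z -> z < w ->
  slope a w <= slope a z.
Proof.
move=> Ia Iz Iw az zw; rewrite /slope.
have aw := lt_trans az zw.
rewrite ler_pdivrMr ?subr_gt0// mulrAC ler_pdivlMr ?subr_gt0//.
have := f_concave Ia Iw az zw; lra.
Qed.

Lemma slope_le_ord x y x' y' : I x -> I y -> I x' -> I y' ->
  x < y -> x' < y' -> x' <= x -> y' <= y -> slope x y <= slope x' y'.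
Proof.
move=> Ix Iy Ix' Iy' xy xy' xx yy.
apply: (@le_trans _ _ (slope x' y)).
  move: xx; rewrite le_eqVlt => /predU1P[->//|xx].
  by apply: slope_mono_l => //; exact: lt_trans xx xy.
move: yy; rewrite le_eqVlt => /predU1P[->//|yy].
exact: slope_mono_r.
Qed.

(** The slopes of the chords of a concave function decrease in both endpoints, whatever
    the order of the endpoints. *)
Lemma slope_le x y x' y' : I x -> I y -> I x' -> I y' ->
  x != y -> x' != y' -> x' <= x -> y' <= y -> slope x y <= slope x' y'.
Proof.
move=> Ix Iy Ix' Iy' xy xy' xx yy.
have [lxy|lyx|e] := ltgtP x y; last by rewrite e eqxx in xy.
- have [lxy'|lyx'|e'] := ltgtP x' y'; last by rewrite e' eqxx in xy'.
  + exact: slope_le_ord.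
  + rewrite (slopeC x' y'); apply: slope_le_ord => //; lra.
- rewrite (slopeC x y).
  have [lxy'|lyx'|e'] := ltgtP x' y'; last by rewrite e' eqxx in xy'.
  + apply: slope_le_ord => //; lra.
  + rewrite (slopeC x' y'); exact: slope_le_ord.
Qed.

(** Summation by parts, organized as an induction on [n]: indices where [x] and [y] agree
    contribute nothing to either side; at any other last index, the slope there
    bounds all earlier slopes, so it can replace [s] for the first [n] terms, and the
    partial sums being nonnegative allow to go back to [s]. *)
Lemma karamata_aux (x y : nat -> R) n (s : R) :
  (forall i, (i < n)%N -> I (x i)) -> (forall i, (i < n)%N -> I (y i)) ->
  (forall i j, (i <= j)%N -> (j < n)%N -> x j <= x i) ->
  (forall i j, (i <= j)%N -> (j < n)%N -> y j <= y i) ->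
  (forall k, (k <= n)%N -> \sum_(i < k) x i <= \sum_(i < k) y i) ->
  (forall i, (i < n)%N -> x i != y i -> slope (x i) (y i) <= s) ->
  \sum_(i < n) (f (y i) - f (x i)) <= s * \sum_(i < n) (y i - x i).
Proof.
elim: n s => [|n IH] s Ix Iy xd yd le_sum hs; first by rewrite !big_ord0 mulr0.
have S0 : 0 <= \sum_(i < n.+1) (y i - x i).
  by rewrite sumrB subr_ge0; exact: le_sum.
have IHn s' : (forall i, (i < n)%N -> x i != y i -> slope (x i) (y i) <= s') ->
    \sum_(i < n) (f (y i) - f (x i)) <= s' * \sum_(i < n) (y i - x i).
  apply: IH.
  - by move=> i ni; apply: Ix; exact: ltnW.
  - by move=> i ni; apply: Iy; exact: ltnW.
  - by move=> i j ij jn; apply: xd => //; exact: ltnW.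
  - by move=> i j ij jn; apply: yd => //; exact: ltnW.
  - by move=> k kn; apply: le_sum; exact: leqW.
have [e|ne] := eqVneq (x n) (y n).
  rewrite !big_ord_recr /= e !subrr !addr0; apply: IHn => i ni.
  by apply: hs; exact: ltnW.
set t := slope (x n) (y n).
have ts : t <= s by apply: hs.
apply: (@le_trans _ _ (t * \sum_(i < n.+1) (y i - x i))); last by rewrite ler_wpM2r.
rewrite !big_ord_recr /= mulrDr; apply: lerD.
  apply: IHn => i ni xy; apply: slope_le => //.
  - by apply: Ix; exact: ltnW.
  - by apply: Iy; exact: ltnW.
  - exact: Ix.
  - exact: Iy.
  - by apply: xd => //; exact: ltnW.
  - by apply: yd => //; exact: ltnW.
by rewrite /t /slope divfK// subr_eq0 eq_sym.
Qed.

Lemma karamata (x y : nat -> R) n :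
  (forall i, (i < n)%N -> I (x i)) -> (forall i, (i < n)%N -> I (y i)) ->
  (forall i j, (i <= j)%N -> (j < n)%N -> x j <= x i) ->
  (forall i j, (i <= j)%N -> (j < n)%N -> y j <= y i) ->
  (forall k, (k < n)%N -> \sum_(i < k) x i <= \sum_(i < k) y i) ->
  \sum_(i < n) x i = \sum_(i < n) y i ->
  \sum_(i < n) f (y i) <= \sum_(i < n) f (x i).
Proof.
move=> Ix Iy xd yd le_sum eq_sum.
rewrite -subr_le0 -sumrB.
(* Any upper bound of the slopes will do, since the total sums agree. *)
apply: le_trans (@karamata_aux x y n (\sum_(i < n) `|slope (x i) (y i)|) _ _ _ _ _ _) _ => //.
- by move=> k; rewrite leq_eqVlt => /predU1P[->|/le_sum//]; rewrite eq_sum.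
- move=> i ni _; apply: le_trans (ler_norm _) _.
  rewrite (bigD1 (Ordinal ni))//= lerDl.
  exact: sumr_ge0.
- by rewrite sumrB eq_sum subrr mulr0.
Qed.

End karamata.

(** * Schur concavity of products of log-concave functions *)

Section schur.
Context (R : realType).
Implicit Types (n : nat).

Lemma size_sort_decr n (x : 'rV[R]_n) : size (sort_decr x) = n.
Proof. by rewrite size_sort size_map size_enum_ord. Qed.

Lemma sort_decr_nth n (x : 'rV[R]_n) i j : (i <= j)%N -> (j < n)%N ->
  (sort_decr x)`_j <= (sort_decr x)`_i.
Proof.
move=> ij jn.
have st : sorted (fun s t : R => t <= s) (sort_decr x).
  by apply: sort_sorted => s t; exact: le_total.
apply: (sorted_leq_nth (leT := fun s t : R => t <= s)) => //.
- by move=> a b c ba ac; exact: le_trans ac ba.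
- by rewrite inE size_sort_decr (leq_ltn_trans ij).
- by rewrite inE size_sort_decr.
Qed.

Lemma sort_decr_in n (x : 'rV[R]_n) i : (i < n)%N -> exists j, (sort_decr x)`_i = x 0 j.
Proof.
move=> ni.
have : (sort_decr x)`_i \in sort_decr x by rewrite mem_nth// size_sort_decr.
by rewrite mem_sort => /mapP[j _ ->]; exists j.
Qed.

Lemma prod_sort_decr n (x : 'rV[R]_n) (F : R -> R) :
  \prod_(i < n) F (x 0 i) = \prod_(i < n) F (sort_decr x)`_i.
Proof.
transitivity (\prod_(z <- [seq x 0 i | i <- enum 'I_n]) F z).
  by rewrite big_map big_enum.
rewrite (perm_big (sort_decr x)); last by rewrite perm_sym; exact/permEl/perm_sort.
by rewrite (big_nth 0) size_sort_decr big_mkord.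
Qed.

Variable g : R^o -> R.
Hypothesis g_logconcave : log_concave_on [set t : R^o | 0 <= t] g.
Hypothesis g0 : 0 < g 0.

Let I (z : R) := 0 <= z /\ 0 < g z.

Lemma logconcave_between (u v w : R) : 0 <= u -> u < v -> v < w ->
  g u `^ ((w - v) / (w - u)) * g w `^ ((v - u) / (w - u)) <= g v.
Proof.
move=> u0 uv vw; have uw := lt_trans uv vw.
have [_ /(_ u w ((w - v) / (w - u)))] := g_logconcave.
have wu0 : w - u != 0 by rewrite gt_eqF// subr_gt0.
have -> : 1 - (w - v) / (w - u) = (v - u) / (w - u) by field.
have -> : (w - v) / (w - u) *: (u : R^o) + (v - u) / (w - u) *: (w : R^o) = v.
  by rewrite /GRing.scale/=; field.
apply => /=; [by []|lra|].
by rewrite divr_gt0 ?subr_gt0//= ltr_pdivrMr ?subr_gt0// mul1r; lra.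
Qed.

(** The points where a log-concave function is positive form an interval. *)
Lemma I_between u v w : I u -> I w -> u <= v -> v <= w -> I v.
Proof.
move=> Iu Iw; rewrite le_eqVlt => /predU1P[<-//|uv].
rewrite le_eqVlt => /predU1P[->//|vw].
have [u0 gu] := Iu; have [w0 gw] := Iw; split; first lra.
apply: lt_le_trans (logconcave_between u0 uv vw).
by rewrite mulr_gt0// powR_gt0.
Qed.

Lemma ln_concave u v w : I u -> I w -> u < v -> v < w ->
  (ln (g w) - ln (g v)) * (v - u) <= (ln (g v) - ln (g u)) * (w - v).
Proof.
move=> Iu Iw uv vw; have uw := lt_trans uv vw.
have [u0 gu] := Iu; have [w0 gw] := Iw.
have [v0 gv] := I_between Iu Iw (ltW uv) (ltW vw).
have := logconcave_between u0 uv vw.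
rewrite -ler_ln ?posrE ?mulr_gt0 ?powR_gt0// lnM ?posrE ?powR_gt0// !ln_powR.
have wu : 0 < w - u by rewrite subr_gt0.
rewrite -(ler_pM2r wu) mulrDl.
have -> : (w - v) / (w - u) * ln (g u) * (w - u) = (w - v) * ln (g u).
  by field; rewrite gt_eqF.
have -> : (v - u) / (w - u) * ln (g w) * (w - u) = (v - u) * ln (g w).
  by field; rewrite gt_eqF.
lra.
Qed.

(** If some factor for [y] vanishes there is nothing to prove. Otherwise [g] is positive
    at 0 and at the largest coordinate of [y], hence at all the coordinates of [x], and
    Karamata's inequality applies to [ln \o g]. *)
Lemma prod_schur n (x y : 'rV[R]_n) (s : R) : 0 <= s ->
  orthant x -> orthant y -> majorized x y ->
  \prod_(i < n) g (y 0 i * s) <= \prod_(i < n) g (x 0 i * s).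
Proof.
move=> s0 x0 y0 [maj1 maj2].
rewrite (prod_sort_decr x (fun z => g (z * s))) (prod_sort_decr y (fun z => g (z * s))).
set xs := sort_decr x; set ys := sort_decr y.
have xs0 i : (i < n)%N -> 0 <= xs`_i * s.
  by move=> ni; have [j ->] := sort_decr_in x ni; rewrite mulr_ge0.
have ys0 i : (i < n)%N -> 0 <= ys`_i * s.
  by move=> ni; have [j ->] := sort_decr_in y ni; rewrite mulr_ge0.
have gx i : (i < n)%N -> 0 <= g (xs`_i * s) by move=> ni; apply: g_logconcave.1; exact: xs0.
have gy i : (i < n)%N -> 0 <= g (ys`_i * s) by move=> ni; apply: g_logconcave.1; exact: ys0.
have [/existsP[i /eqP gi]|/existsPn gn0] := boolP [exists i : 'I_n, g (ys`_i * s) == 0].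
  by rewrite (bigD1 i)//= gi mul0r; apply: prodr_ge0 => j _; exact: gx.
have Iy i : (i < n)%N -> I (ys`_i * s).
  move=> ni; split; first exact: ys0.
  by rewrite lt_neqAle gy// andbT eq_sym; exact: (gn0 (Ordinal ni)).
have xy0 : (0 < n)%N -> xs`_0 <= ys`_0.
  case: n x y x0 y0 maj1 maj2 @xs @ys xs0 ys0 gx gy gn0 Iy => // -[|n] x y x0 y0 maj1 maj2 xs ys _ _ _ _ _ _ _.
    by move: maj2; rewrite !big_ord_recl !big_ord0 !addr0 /= => ->.
  by have := maj1 1%N isT; rewrite !big_ord_recl !big_ord0 !addr0.
have Ix i : (i < n)%N -> I (xs`_i * s).
  move=> ni; have n0 : (0 < n)%N by exact: leq_ltn_trans ni.
  apply: (@I_between 0 _ (ys`_0 * s)).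
  - by split.
  - exact: Iy.
  - exact: xs0.
  - rewrite ler_wpM2r//; apply: le_trans (xy0 n0).
    exact: sort_decr_nth.
have := @karamata R I (fun z => ln (g z)) ln_concave (fun i => xs`_i * s) (fun i => ys`_i * s) n Ix Iy.
have expprod (z : nat -> R) : (forall i, (i < n)%N -> I (z i)) ->
    \prod_(i < n) g (z i) = expR (\sum_(i < n) ln (g (z i))).
  move=> Iz; rewrite expR_sum; apply: eq_bigr => i _.
  by rewrite lnK// posrE; case: (Iz i (ltn_ord i)).
rewrite (expprod (fun i => xs`_i * s))// (expprod (fun i => ys`_i * s))// ler_expR; apply.
- by move=> i j ij jn; rewrite ler_wpM2r//; exact: sort_decr_nth.
- by move=> i j ij jn; rewrite ler_wpM2r//; exact: sort_decr_nth.
- move=> k kn; rewrite -!mulr_suml ler_wpM2r//.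
  case: k kn => [|k] kn; first by rewrite !big_ord0.
  exact: maj1.
- by rewrite -!mulr_suml maj2.
Qed.

End schur.

(** * Dilations of the triangular law, and the value at the origin *)

Section triangle_probability.
Context (R : realType).
Local Notation leb := (@lebesgue_measure R).

Lemma sintr_triangle z : \int[leb]_t (triangle t * sin (2 * pi * z * t)) = 0.
Proof.
set b := 2 * pi * z.
have cs : continuous (fun t : R => sin (b * t)).
  move=> x; apply: (@continuous_cvg _ _ _ _ _ _ (@sin R)); first exact: continuous_sin.
  by apply: cvgM; [exact: cvg_cst|exact: cvg_id].
have [bE|b0] := eqVneq b 0.
  under eq_Rintegral do rewrite bE mul0r sin0 mulr0.
  by rewrite /Rintegral integral0.
rewrite (Rintegral_triangle cs).
have ds := is_derive_sinM b; have dc := is_derive_cosM b.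
have d1 (x : R) : is_derive x (1 : R)
    (fun t => - (1 + t) * (cos (b * t) / b) + sin (b * t) / b ^+ 2)
    ((1 + x) * sin (b * x)).
  by apply: is_derive_eq; rewrite /GRing.scale/=; field.
have d2 (x : R) : is_derive x (1 : R)
    (fun t => - (1 - t) * (cos (b * t) / b) - sin (b * t) / b ^+ 2)
    ((1 - x) * sin (b * x)).
  by apply: is_derive_eq; rewrite /GRing.scale/=; field.
have k1 : continuous (fun t : R => (1 + t) * sin (b * t)).
  by move=> x; apply: cvgM; [apply: cvgD; [exact: cvg_cst|exact: cvg_id]|exact: cs].
have k2 : continuous (fun t : R => (1 - t) * sin (b * t)).
  by move=> x; apply: cvgM; [apply: cvgB; [exact: cvg_cst|exact: cvg_id]|exact: cs].
rewrite (continuous_FTC (ltrN10 R) k1 d1) (continuous_FTC ltr01 k2 d2).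
by rewrite !mulr0 !mulr1 mulrN mulr1 cosN sinN cos0 sin0; field.
Qed.

(** The probability with density [triangle]. *)
Definition triangle_prob (A : set (measurableTypeR R)) : \bar R :=
  (\int[leb]_(x in A) (triangle x)%:E)%E.

Let triangle_prob0 : triangle_prob set0 = 0%E.
Proof. by rewrite /triangle_prob integral_set0. Qed.

Let triangle_prob_ge0 A : (0 <= triangle_prob A)%E.
Proof. by apply: integral_ge0 => x _; rewrite lee_fin triangle_ge0. Qed.

Let triangle_prob_sigma_additive : semi_sigma_additive triangle_prob.
Proof.
move=> /= F mF tF mUF; rewrite /triangle_prob; apply: cvg_toP.
  apply: ereal_nondecreasing_is_cvgn => m n mn.
  apply: lee_sum_nneg_natr => // k _ _; exact: triangle_prob_ge0.
rewrite ge0_integral_bigcup//=.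
- by apply: measurable_funTS; apply/measurable_EFinP; exact: measurable_triangle.
- by move=> x _; rewrite lee_fin triangle_ge0.
Qed.

HB.instance Definition _ := isMeasure.Build _ _ _ triangle_prob
  triangle_prob0 triangle_prob_ge0 triangle_prob_sigma_additive.

Let triangle_prob_setT : triangle_prob [set: _] = 1%E.
Proof.
have := Rintegral_triangle1 R; rewrite /Rintegral => e.
rewrite /triangle_prob -[RHS]/(1%R%:E) -e fineK//.
exact: (integrable_fin_num measurableT (@Rintegrable_triangle R)).
Qed.

HB.instance Definition _ := @Measure_isProbability.Build _ _ R
  triangle_prob triangle_prob_setT.

Definition dilation (r x : measurableTypeR R) : measurableTypeR R := r * x.

Lemma measurable_dilation r : measurable_fun setT (dilation r).
Proof. exact: measurable_funM. Qed.

HB.instance Definition _ r := @isMeasurableFun.Build _ _ _ _ (dilation r)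
  (measurable_dilation r).

(** The law of [r * X] when [X] has density [triangle]. *)
Definition dilated_triangle (r : R) : probability (measurableTypeR R) R :=
  distribution triangle_prob (dilation r).

Lemma dilated_triangle_integral (r : R) (f : R -> R) : measurable_fun [set: R] f ->
  (forall x, `|f x| <= 1) ->
  \int[dilated_triangle r]_x f x = \int[leb]_x (triangle x * f (r * x)).
Proof.
move=> mf f1.
have mfr : measurable_fun [set: R] (fun x => f (r * x)).
  by apply: measurableT_comp mf _; exact: measurable_funM.
have fi := probability_Rintegrable triangle_prob mfr (fun x => f1 _).
rewrite /dilated_triangle Rintegral_distribution// (@Rintegral_density _ _ (@triangle R))//.
  by apply: eq_Rintegral => x _; rewrite mulrC.
by split => //; [exact: measurable_triangle|exact: triangle_ge0].
Qed.

Lemma charf_dilated_triangle r t :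
  charf (dilated_triangle r) t = costr leb (@triangle R) (r * t).
Proof.
rewrite /charf dilated_triangle_integral; last by move=> x; exact: cos_max.
  by apply: eq_Rintegral => x _; congr (_ * cos _); ring.
exact: measurable_cosM.
Qed.

Lemma sin_dilated_triangle r t :
  \int[dilated_triangle r]_x sin (2 * pi * t * x) = 0.
Proof.
rewrite dilated_triangle_integral; last by move=> x; exact: sin_max.
  rewrite -(sintr_triangle (r * t)).
  by apply: eq_Rintegral => x _; congr (_ * sin _); ring.
exact: measurable_sinM.
Qed.

(** The density of the dilated law is at most [r^-1] and vanishes outside the ball of
    radius [r]. *)
Lemma dilated_triangle_le (r : R) (A : set (measurableTypeR R)) : 0 < r -> measurable A ->
  (dilated_triangle r A <= (r^-1)%:E * leb (A `&` ball (0%R : R) r))%E.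
Proof.
move=> r0 mA.
have mB : measurable (ball (0%R : R) r : set (measurableTypeR R)) by exact: measurable_ball.
have mAB := measurableI _ _ mA mB.
have mpre : measurable (dilation r @^-1` A).
  by rewrite -[X in measurable X]setTI; exact: measurable_dilation.
rewrite -[leb (A `&` _)](_ : (\int[leb]_x (\1_(A `&` ball (0%R : R) r) x)%:E = _)%E); last first.
  by rewrite integral_indic// setIT.
rewrite (ge0_integral_affine 0 r0)//; last exact/measurable_EFinP.
rewrite muleA -EFinM mulVf ?gt_eqF// mul1e affine0.
rewrite /dilated_triangle /distribution /pushforward /= /triangle_prob.
rewrite integral_mkcond; apply: ge0_le_integral => //.
- by move=> x _; rewrite erestrict_ge0// => y _; rewrite lee_fin triangle_ge0.
- apply/(measurable_restrictT _ mpre); apply: measurable_funTS.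
  by apply/measurable_EFinP; exact: measurable_triangle.
- apply/measurable_EFinP; apply: (measurableT_comp _ (measurable_dilation r)).
  exact: measurable_indic.
- move=> x _; rewrite patchE; case: ifP => [|_]; last by rewrite lee_fin.
  rewrite inE/= => Ax; rewrite lee_fin indicE.
  have [x1|x1] := lerP 1 `|x|; first by rewrite triangle_out.
  rewrite mem_set ?triangle_le1//; split => //.
  by rewrite /ball/= sub0r normrN normrM gtr0_norm// -ltr_pdivlMl// mulVf// gt_eqF.
Qed.

End triangle_probability.

Section origin.
Context (R : realType).
Local Notation leb := (@lebesgue_measure R).
Local Notation P := (costr leb (@triangle R)).
Local Notation c := (\int[leb]_z P z).
Variable hhat : R -> R[i].
Hypothesis hhat_ge0 : {ae leb, forall x, 0 <= hhat x}.
Hypothesis hhat_L2 : complex_Lfun 2%:E hhat.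
Variable h : R -> R.
Hypothesis h_L2 : h \in Lfun leb 2%:E.
Hypothesis h_hhat : is_fourierL2 h hhat.
Hypothesis h0 : lebesgue_pt h 0.

(** The mean deviation from [h 0] under the dilated law is controlled by the average over
    the ball of radius [r] that defines Lebesgue points; the factor 2 is the ratio
    between the maximum of the density and that of the uniform law. *)
Lemma dilated_triangle_davg (r : R) : 0 < r -> measurable_fun [set: R] h ->
  (\int[dilated_triangle r]_x `|(h x - h 0)%:E| <= 2%:E * davg h 0 r)%E.
Proof.
move=> r0 mh.
have mB : measurable (ball (0 : R) r : set (measurableTypeR R)) by exact: measurable_ball.
have ri0 : 0 <= r^-1 by rewrite invr_ge0 ltW.
pose m2 := mscale (NngNum ri0) leb.
have md : measurable_fun [set: R] (fun x => `|(h x - h 0)%:E|%E).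
  by apply: measurableT_comp => //; apply/measurable_EFinP; exact: measurable_funB.
have mdB : measurable_fun [set: R] ((fun x => `|(h x - h 0)%:E|%E) \_ (ball (0 : R) r)).
  by apply/(measurable_restrictT _ mB); exact: measurable_funTS.
have mBC : measurable (~` ball (0 : R) r : set (measurableTypeR R)) by exact: measurableC.
have nuBC : dilated_triangle r (~` ball (0 : R) r) = 0%E.
  apply/eqP; rewrite eq_le measure_ge0 andbT.
  by apply: le_trans (dilated_triangle_le r0 mBC) _; rewrite setICl measure0 mule0.
rewrite (ge0_negligible_integral mBC measurableT md _ nuBC)//.
rewrite setTD setCK integral_mkcond.
apply: (@le_trans _ _ (\int[m2]_x ((fun x => `|(h x - h 0)%:E|%E) \_ (ball (0%R : R) r)) x)%E).
  apply: ge0_integral_le_measure => [A mA|x].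
    apply: le_trans (dilated_triangle_le r0 mA) _.
    rewrite lee_wpmul2l ?lee_fin//; apply: le_measure; rewrite ?inE//.
    exact: measurableI.
  by apply: erestrict_ge0.
rewrite ge0_integral_mscale//=; last by move=> x _; apply: erestrict_ge0.
rewrite -integral_mkcond /davg /iavg lebesgue_measure_ball ?(ltW r0)//.
rewrite inver mulrn_eq0/= gt_eqF// muleA -EFinM.
by rewrite (_ : 2 * (r *+ 2)^-1 = r^-1)// -mulr_natr; field; rewrite gt_eqF.
Qed.

(** The inversion formula for the dilated triangular laws reads
    [c * \int h dnu_r = \int P(r t) * Re_pos(t) dt], with [P] the Fejer kernel and
    [P 0 = 1]. *)
Lemma lebesgue_pt_origin : Rintegrable leb (Re_pos hhat) /\
  \int[leb]_t Re_pos hhat t <= c * h 0.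
Proof.
pose r (n : nat) : R := n.+1%:R^-1.
have r0 n : 0 < r n by rewrite invr_gt0.
have r_cvg : r n @[n --> \oo] --> (0 : R) := cvg_harmonic.
have sint n := sin_dilated_triangle (r n).
have charE n : charf (dilated_triangle (r n)) = fun t => P (r n * t).
  by apply/funext => t; exact: charf_dilated_triangle.
have Ci n : Rintegrable leb (charf (dilated_triangle (r n))).
  rewrite charE; have := Rintegrable_affine 0 (r0 n) (@Rintegrable_costr_triangle R).
  by rewrite affine0.
have inv n := inversion_pos hhat_ge0 hhat_L2 h_L2 h_hhat (sint n) (Ci n).
have mh : measurable_fun [set: R] h by move: h_L2; rewrite inE => /andP[]; rewrite inE.
have davg0 : davg h 0 (r n) @[n --> \oo] --> 0%E.
  by have /cvge_at_rightP := h0; apply; split.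
have lim : \int[dilated_triangle (r n)]_x h x @[n --> \oo] --> h 0.
  apply: (@cvg_of_ereal_bound _ _ _ _ 2 _ davg0) => n.
  have [hi _ _] := inv n.
  have h0i : Rintegrable (dilated_triangle (r n)) (fun=> h 0).
    exact: finite_measure_integrable_cst.
  have hhi := RintegrableB hi h0i.
  rewrite -[X in (`|_ - X|)](Rintegral_prob1 (dilated_triangle (r n)) (h 0)) -RintegralB//.
  rewrite EFin_normr_Rintegral//.
  apply: le_trans (le_abse_integral _ measurableT (measurable_int _ hhi)) _.
  exact: dilated_triangle_davg.
have mP n : measurable_fun [set: R] (fun t => P (r n * t)).
  apply: (measurableT_comp (@measurable_costr_triangle R)).
  exact: (measurable_dilation (r n)).
have mR := measurable_Re_pos hhat_L2.
have fat : (\int[leb]_t (Re_pos hhat t)%:E <= (c * h 0)%:E)%E.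
  pose F n t := (P (r n * t) * Re_pos hhat t)%:E.
  have mF n : measurable_fun [set: R] (F n).
    by apply/measurable_EFinP; exact: measurable_funM.
  have F0 n t : [set: R] t -> (0 <= F n t)%E.
    by move=> _; rewrite lee_fin mulr_ge0 ?costr_triangle_ge0 ?Re_pos_ge0.
  have limF t : F n t @[n --> \oo] --> (Re_pos hhat t)%:E.
    apply/cvg_EFin; first exact: nearW.
    rewrite /= -[X in _ --> X]mul1r -(costr_triangle0 R); apply: cvgMl.
    apply: (@continuous_cvg _ _ _ _ _ _ P).
      exact: continuous_costr (@Rintegrable_triangle R) _.
    by rewrite -[X in _ --> X](mul0r t); exact: cvgMl.
  have intF n : (\int[leb]_t F n t)%E = (c * \int[dilated_triangle (r n)]_x h x)%:E.
    have [_ i1 ->] := inv n; rewrite charE in i1 *.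
    by rewrite fineK//; exact: (integrable_fin_num measurableT i1).
  have limI : (\int[leb]_t F n t)%E @[n --> \oo] --> (c * h 0)%:E.
    rewrite (_ : (fun n => _) = fun n => (c * \int[dilated_triangle (r n)]_x h x)%:E).
      by apply/cvg_EFin; [exact: nearW|exact: cvgMr].
    by apply/funext.
  have := fatou leb measurableT mF F0.
  rewrite (is_cvg_limn_einfE (cvgP _ limI)) (cvg_lim _ limI)//.
  apply: le_trans; rewrite le_eqVlt; apply/orP; left; apply/eqP.
  apply: eq_integral => t _.
  by rewrite (is_cvg_limn_einfE (cvgP _ (limF t))) (cvg_lim _ (limF t)).
have Ri : Rintegrable leb (Re_pos hhat).
  apply/integrableP; split; first exact/measurable_EFinP.
  under eq_integral do rewrite /= ger0_norm ?Re_pos_ge0//.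
  exact: le_lt_trans fat (ltry _).
split => //.
by rewrite -lee_fin fineK//; exact: (integrable_fin_num measurableT Ri).
Qed.

End origin.

(** * Mixtures of products *)

Section mixture.
Context (R : realType).
Local Notation leb := (@lebesgue_measure R).

Lemma sum_sort_decr n (x : 'rV[R]_n) :
  \sum_(i < n) (sort_decr x)`_i = \sum_(i < n) x 0 i.
Proof.
transitivity (\sum_(z <- [seq x 0 i | i <- enum 'I_n]) z); last first.
  by rewrite big_map big_enum.
rewrite [RHS](perm_big (sort_decr x)); last by rewrite perm_sym; exact/permEl/perm_sort.
by rewrite [RHS](big_nth 0) size_sort_decr big_mkord.
Qed.

Lemma powR_prod n (F : 'I_n -> R) (l : R) : (forall i, 0 <= F i) ->
  \prod_(i < n) (F i `^ l) = (\prod_(i < n) F i) `^ l.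
Proof.
elim: n F => [|n IH] F F0; first by rewrite !big_ord0 powR1.
by rewrite !big_ord_recl IH// powRM// prodr_ge0.
Qed.

Lemma powR_split (x l : R) : 0 <= x -> 0 < l < 1 -> x `^ l * x `^ (1 - l) = x.
Proof.
move=> x0 /andP[l0 l1].
have [->|xn0] := eqVneq x 0; first by rewrite powR0 ?mul0r// gt_eqF.
by rewrite -powRD ?subrKC ?powRr1// xn0 implybT.
Qed.

Lemma orthant_neq0 n (a : 'rV[R]_n) : orthant a -> a != 0 -> exists i, 0 < a 0 i.
Proof.
move=> a0 an0; apply/existsP; apply: contraR an0 => /existsPn an.
apply/eqP/rowP => i; rewrite mxE; apply/eqP; rewrite eq_le a0 andbT leNgt.
exact: an.
Qed.

Variables (q : R) (n : nat) (g : R^o -> R) (rho : R -> R) (c : R).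
Variable H : 'rV[R]_n -> R.
Hypothesis g_ge0 : forall s, 0 <= g s.
Hypothesis g0 : g 0 = 1.
Hypothesis rho_ge0 : forall t, 0 <= rho t.
Hypothesis c_gt0 : 0 < c.

(** The product [\prod_i g (a_i * s)] at [s = `|t| `^ q]. *)
Definition weight (a : 'rV[R]_n) (t : R) : R := \prod_(i < n) g (a 0 i * `|t| `^ q).

Lemma weight_ge0 a t : 0 <= weight a t.
Proof. by apply: prodr_ge0 => i _; exact: g_ge0. Qed.

Let J (a : 'rV[R]_n) := \int[leb]_t (weight a t * rho t).
Let J_integrable (a : 'rV[R]_n) := Rintegrable leb (fun t => weight a t * rho t).

Hypothesis H_formula : forall a, orthant a -> a != 0 -> J_integrable a /\ c * H a = J a.

Lemma weight_integral_ge0 a : 0 <= J a.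
Proof. by apply: Rintegral_ge0 => t _; rewrite mulr_ge0 ?weight_ge0 ?rho_ge0. Qed.

Lemma mixture_ge0 a : orthant a -> a != 0 -> 0 <= H a.
Proof.
move=> a0 an0; have [_ e] := H_formula a0 an0.
by rewrite -(pmulr_rge0 _ c_gt0) e weight_integral_ge0.
Qed.

Section convex.
Hypothesis g_convex : log_convex_on [set t : R^o | 0 <= t] g.

Lemma weight_convex (x y : 'rV[R]_n) (l t : R) : orthant x -> orthant y -> 0 < l < 1 ->
  weight (l *: x + (1 - l) *: y) t <= weight x t `^ l * weight y t `^ (1 - l).
Proof.
move=> x0 y0 l01; rewrite /weight -!powR_prod; try by move=> i; exact: g_ge0.
rewrite -big_split/=; apply: ler_prod => i _; rewrite g_ge0/=.
have [_ /(_ (x 0 i * `|t| `^ q) (y 0 i * `|t| `^ q) l)] := g_convex.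
rewrite /= /GRing.scale/= !mxE !mulrA -mulrDl; apply => //.
- by rewrite mulr_ge0 ?powR_ge0.
- by rewrite mulr_ge0 ?powR_ge0.
Qed.

Lemma weight_integral_log_convex (x y : 'rV[R]_n) (l : R) : orthant x -> orthant y -> 0 < l < 1 ->
  J_integrable x -> J_integrable y -> J_integrable (l *: x + (1 - l) *: y) ->
  J (l *: x + (1 - l) *: y) <= J x `^ l * J y `^ (1 - l).
Proof.
move=> x0 y0 l01 xi yi zi.
have nn a t : 0 <= weight a t * rho t by rewrite mulr_ge0 ?weight_ge0 ?rho_ge0.
apply: Rintegral_geometric_le => // t.
rewrite !powRM ?weight_ge0 ?rho_ge0// mulrACA powR_split ?rho_ge0//.
by rewrite ler_wpM2r ?rho_ge0//; exact: weight_convex.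
Qed.

Lemma orthant_comb (x y : 'rV[R]_n) (l : R) : orthant x -> orthant y -> 0 < l < 1 ->
  orthant (l *: x + (1 - l) *: y).
Proof.
move=> x0 y0 /andP[l0 l1] i; rewrite !mxE addr_ge0// mulr_ge0//; first exact: ltW.
by rewrite subr_ge0 ltW.
Qed.

Lemma comb_eq0 (x y : 'rV[R]_n) (l : R) : orthant x -> orthant y -> 0 < l < 1 ->
  l *: x + (1 - l) *: y = 0 -> x = 0 /\ y = 0.
Proof.
move=> x0 y0 /andP[l0 l1] e.
have e' i : l * x 0 i + (1 - l) * y 0 i = 0.
  by move/rowP : e => /(_ i); rewrite !mxE.
by split; apply/rowP => i; rewrite mxE; have := e' i; have := x0 i; have := y0 i; nra.
Qed.

(** At the endpoints [x] and [y] only the inequality between [c * H] and the integral is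
    needed; this is what allows one of them to be 0. *)
Lemma mixture_log_convex_of_le (x y : 'rV[R]_n) (l : R) : orthant x -> orthant y -> 0 < l < 1 ->
  J_integrable x -> J_integrable y -> J x <= c * H x -> J y <= c * H y ->
  l *: x + (1 - l) *: y != 0 ->
  H (l *: x + (1 - l) *: y) <= H x `^ l * H y `^ (1 - l).
Proof.
move=> x0 y0 l01 xi yi Jx Jy zn0.
have z0 := orthant_comb x0 y0 l01.
have [zi ze] := H_formula z0 zn0.
have c0 := c_gt0.
have Hx : 0 <= H x by rewrite -(pmulr_rge0 _ c0) (le_trans (weight_integral_ge0 x)).
have Hy : 0 <= H y by rewrite -(pmulr_rge0 _ c0) (le_trans (weight_integral_ge0 y)).
have /andP[l0 l1] := l01.
rewrite -(ler_pM2l c0) ze; apply: le_trans (weight_integral_log_convex x0 y0 l01 xi yi zi) _.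
rewrite -{1}(powR_split (ltW c0) l01) mulrACA -!powRM ?(ltW c0)//.
apply: ler_pM; rewrite ?powR_ge0// ge0_ler_powR ?nnegrE ?weight_integral_ge0 ?mulr_ge0 ?(ltW c0)//.
- exact: ltW.
- by rewrite subr_ge0 ltW.
Qed.

Lemma mixture_log_convex : log_convex_on (@orthant R n `\ 0) H.
Proof.
split => [x [x0 xn0]|x y l [x0 xn0] [y0 yn0] l01].
  by apply: mixture_ge0 => //; apply/eqP.
have [xi xe] := H_formula x0 (introN eqP xn0).
have [yi ye] := H_formula y0 (introN eqP yn0).
apply: mixture_log_convex_of_le => //; rewrite ?xe ?ye//.
by apply/eqP => /(comb_eq0 x0 y0 l01)[/xn0].
Qed.

Lemma mixture_log_convex0 : Rintegrable leb rho -> \int[leb]_t rho t <= c * H 0 ->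
  log_convex_on (@orthant R n) H.
Proof.
move=> Ri Rle.
have w0 t : weight 0 t = 1.
  by rewrite /weight big1// => i _; rewrite mxE mul0r g0.
have J0 : J_integrable 0 /\ J 0 <= c * H 0.
  have e : (fun t => weight 0 t * rho t) = rho.
    by apply/funext => t; rewrite w0 mul1r.
  by rewrite /J_integrable /J e.
have Jall a : orthant a -> J_integrable a /\ J a <= c * H a.
  move=> a0; have [->//|an0] := eqVneq a 0.
  by have [ai ->] := H_formula a0 an0.
have H0 a : orthant a -> 0 <= H a.
  by move=> /Jall[_]; rewrite -(pmulr_rge0 _ c_gt0); apply: le_trans (weight_integral_ge0 a).
split => // x y l x0 y0 l01.
have [xi xe] := Jall x x0; have [yi ye] := Jall y y0.
have [e|zn0] := eqVneq (l *: x + (1 - l) *: y) 0.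
  have [x00 y00] := comb_eq0 x0 y0 l01 e.
  by rewrite e x00 y00 powR_split// -x00 H0.
exact: mixture_log_convex_of_le.
Qed.

End convex.

Section concave.
Hypothesis g_concave : log_concave_on [set t : R^o | 0 <= t] g.

Lemma majorized_eq0 (x y : 'rV[R]_n) : orthant x -> orthant y -> majorized x y ->
  (x == 0) = (y == 0).
Proof.
have eq0 (a : 'rV[R]_n) : orthant a -> (a == 0) = (\sum_(i < n) a 0 i == 0).
  move=> a0; apply/eqP/eqP => [->|/eqP].
    by rewrite big1// => i _; rewrite mxE.
  rewrite psumr_eq0 => [/allP s0|i _]; last exact: a0.
  by apply/rowP => i; rewrite mxE; apply/eqP; apply: s0; rewrite mem_index_enum.
by move=> x0 y0 [_]; rewrite !sum_sort_decr (eq0 x)// (eq0 y)// => ->.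
Qed.

Lemma mixture_schur_concave : schur_concave_on (@orthant R n) H.
Proof.
move=> x y x0 y0 maj; have xy0 := majorized_eq0 x0 y0 maj.
have [ye|yn0] := eqVneq y 0.
  by move: xy0; rewrite ye eqxx => /eqP ->.
have xn0 : x != 0 by rewrite xy0.
have [xi xe] := H_formula x0 xn0; have [yi ye] := H_formula y0 yn0.
rewrite -(ler_pM2l c_gt0) xe ye; apply: le_Rintegral => // t _.
rewrite ler_wpM2r ?rho_ge0//.
by apply: prod_schur => //; rewrite g0.
Qed.

End concave.

End mixture.

(** * Integral representation of the function H *)

Section integral_representation.
Context (R : realType).
Local Notation leb := (@lebesgue_measure R).
Local Notation P := (costr leb (@triangle R)).
Local Notation c := (\int[leb]_z P z).
Variables (q : R) (n : nat) (mu : probability (measurableTypeR R) R) (phi : R -> R).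
Variables (h : R -> R) (hhat : R -> R[i]).
Hypothesis q_gt0 : 0 < q.
Hypothesis mu_phi : is_density mu phi.
Hypothesis fphi_ge0 : forall x, 0 <= fourier phi x.
Hypothesis fphi_int : complex_Lfun 1%E (fourier phi).
Hypothesis h_L2 : h \in Lfun leb 2%:E.
Hypothesis h_hhat : is_fourierL2 h hhat.
Hypothesis hhat_ge0 : {ae leb, forall x, 0 <= hhat x}.

Lemma charf_fourier t : charf mu t = complex.Re (fourier phi t).
Proof.
rewrite /charf (Rintegral_density mu_phi).
  by apply: eq_Rintegral => x _; rewrite mulrC.
exact: (probability_Rintegrable mu (measurable_cosM _) (fun x => cos_max _)).
Qed.

Lemma Rintegral_sin_eq0 t : \int[mu]_x sin (2 * pi * t * x) = 0.
Proof.
rewrite (Rintegral_density mu_phi); last first.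
  exact: (probability_Rintegrable mu (measurable_sinM _) (fun x => sin_max _)).
have := fphi_ge0 t; rewrite lecE /= => /andP[/eqP e _].
transitivity (\int[leb]_y (phi y * sin (2 * pi * t * y))).
  by apply: eq_Rintegral => x _; rewrite mulrC.
by apply/eqP; rewrite -oppr_eq0 e.
Qed.

Lemma Rintegrable_charf_mu : Rintegrable leb (charf mu).
Proof.
have -> : charf mu = fun t => complex.Re (fourier phi t) by apply/funext => t; exact: charf_fourier.
by apply/Lfun1_integrable; case: fphi_int.
Qed.

Let g (s : R^o) : R := complex.Re (fourier phi (s `^ q^-1)).

Lemma Re_fourier_powRE s : g s = charf mu (s `^ q^-1).
Proof. by rewrite charf_fourier. Qed.

Lemma Re_fourier_powR_ge0 s : 0 <= g s.
Proof. by have := fphi_ge0 (s `^ q^-1); rewrite lecE => /andP[]. Qed.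

Lemma Re_fourier_powR0 : g 0 = 1.
Proof.
rewrite Re_fourier_powRE powR0 ?invr_eq0 ?gt_eqF// /charf.
under eq_Rintegral do rewrite mulr0 mul0r cos0.
exact: Rintegral_prob1.
Qed.

Lemma charf_norm t : charf mu `|t| = charf mu t.
Proof. by case: (ger0P t) => // _; rewrite charfE costrN. Qed.

Lemma charf_powR_mul (a t : R) : 0 <= a -> charf mu (a `^ q^-1 * t) = g (a * `|t| `^ q).
Proof.
move=> a0; rewrite Re_fourier_powRE powRM ?powR_ge0// -powRrM divff ?gt_eqF// powRr1//.
by rewrite -charf_norm normrM ger0_norm ?powR_ge0.
Qed.

(** For [a <> 0] some coefficient is positive, which makes the characteristic function
    of the sum integrable. *)
Lemma Hfun_representation (a : 'rV[R]_n) : orthant a -> a != 0 -> Rintegrable leb (fun t => weight q g a t * Re_pos hhat t) /\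
  c * Hfun q mu h a = \int[leb]_t (weight q g a t * Re_pos hhat t).
Proof.
move=> a0 an0; have [i ai] := orthant_neq0 a0 an0.
have ali : 0 < a 0 i `^ q^-1 by rewrite powR_gt0.
have [h1 h2] := integral_lincomb hhat_ge0 (proj1 h_hhat) h_L2 h_hhat Rintegral_sin_eq0 Rintegrable_charf_mu
  (al := fun j => a 0 j `^ q^-1) ali.
have e : (fun t => \prod_(j < n) charf mu (a 0 j `^ q^-1 * t) * Re_pos hhat t) =
         (fun t => weight q g a t * Re_pos hhat t).
  apply/funext => t; congr (_ * _); apply: eq_bigr => j _.
  by rewrite charf_powR_mul.
by rewrite e in h1 h2; split.
Qed.

Lemma Hfun0 : Hfun q mu h (0 : 'rV[R]_n) = h 0.
Proof.
rewrite /Hfun; under eq_Rintegral => x _.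
  rewrite big1; last by move=> i _; rewrite mxE powR0 ?mul0r// invr_eq0 gt_eqF.
  over.
exact: Rintegral_prob1.
Qed.

End integral_representation.

Theorem theorem1p1 (R : realType) (q : R) (n : nat)
    (mu : probability (measurableTypeR R) R) (phi : R -> R)
    (h : R -> R) (hhat : R -> R[i])
    (q_gt0 : 0 < q)
    (mu_phi : is_density mu phi)
    (phi_even : even_fun phi)
    (fphi_ge0 : forall x, 0 <= fourier phi x)
    (fphi_int : complex_Lfun 1%E (fourier phi))
    (h_even : even_fun h)
    (h_L2 : h \in Lfun (@lebesgue_measure R) 2%:E)
    (h_hhat : is_fourierL2 h hhat)
    (hhat_ge0 : {ae @lebesgue_measure R, forall x, 0 <= hhat x}) :
  let fphi_q : R^o -> R := fun t => complex.Re (fourier phi (t `^ q^-1)) in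
  (log_convex_on [set t : R^o | 0 <= t] fphi_q ->
     log_convex_on (@orthant R n `\ 0) (Hfun q mu h) /\
     (lebesgue_pt h 0 -> log_convex_on (@orthant R n) (Hfun q mu h)))
  /\
  (log_concave_on [set t : R^o | 0 <= t] fphi_q ->
     schur_concave_on (@orthant R n) (Hfun q mu h)).
Proof.
move=> fphi_q.
pose c : R := \int[@lebesgue_measure R]_z costr (@lebesgue_measure R) (@triangle R) z.
have c0 : 0 < c := Rintegral_costr_triangle_gt0 R.
have g_ge0 := Re_fourier_powR_ge0 q fphi_ge0.
have g0 := Re_fourier_powR0 q_gt0 mu_phi.
have Hf := @Hfun_representation R q n mu phi h hhat q_gt0 mu_phi fphi_ge0 fphi_int
  h_L2 h_hhat hhat_ge0.
split => [gc|gc].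
  split=> [|h_pt].
    exact: (mixture_log_convex g_ge0 (Re_pos_ge0 hhat) c0 Hf gc).
  have [Ri Rle] := lebesgue_pt_origin hhat_ge0 (proj1 h_hhat) h_L2 h_hhat h_pt.
  apply: (mixture_log_convex0 g_ge0 g0 (Re_pos_ge0 hhat) c0 Hf gc Ri).
  by rewrite Hfun0.
exact: (mixture_schur_concave g0 (Re_pos_ge0 hhat) c0 Hf gc).
Qed.
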